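(* For integers $0\le k\le w$ and $n\ge1$, \[ \sum_{\substack{\lambda:\lambda_1 \le 2w+1\\ r(\lambda)=k}} s_{\lambda}(x_1,\dots,x_n) = \sum_{\substack{(T,S)\in \mathrm{MUD}_n(w; (0^w) \to (0^w))\\ |S|=k}} \omega(T)\,\omega(S). \]
   Context: $s_\lambda(x_1,\dots,x_n)$ is the Schur polynomial in $n$ variables; $r(\lambda)$ is the number of rows of odd length of $\lambda$. Partitions with at most $w$ rows are written as $w$-tuples, e.g. $(0^w)$ is the empty partition. A $w$-up-down tableau of length $2n$ from $\mu$ to $\nu$ is a sequence $T=(T_0,T_1,\dots,T_{2n})$ of partitions with $\mu=T_0\subseteq T_1\supseteq T_2\subseteq T_3\supseteq\cdots\subseteq T_{2n-1}\supseteq T_{2n}=\nu$, such that each pair $(T_{i-1},T_i)$ differs by a vertical strip (at most one cell in each row), and each $T_i$ has at most $w$ rows. Its weight is $\omega(T)=\prod_{i=1}^n x_i^{-|T_{2i-2}|+2|T_{2i-1}|-|T_{2i}|}$. $\mathrm{UD}_n(w;\mu\to\nu)$ is the set of these, and $\mathrm{MUD}_n(w;\mu\to\nu)$ is the set of pairs $(T,S)$ with $T\in\mathrm{UD}_n(w;\mu\to\nu)$ and $S\subseteq\{1,\dots,n\}$. For such $S$, $\omega(S)=\prod_{j\in S}x_j$. *)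

(* Defs.v *)
From mathcomp Require Import all_boot all_order all_algebra zify.
From mathcomp Require Import boolp classical_sets cardinality fsbigop.
From mathcomp Require Import mpoly.

Set Implicit Arguments.
Unset Strict Implicit.
Unset Printing Implicit Defensive.

Import GRing.Theory.

Local Open Scope classical_set_scope.
Local Open Scope ring_scope.

(* A partition is the weakly decreasing sequence of its positive parts, so
   [::] is the empty partition (0^w), the number of rows is size la and the
   row lengths are nth 0 la i (with value 0 past the last row). *)
Definition is_partition (la : seq nat) : bool :=
  sorted geq la && (0%N \notin la).

Definition odd_rows (la : seq nat) : nat := count odd la.

Definition cell (la : seq nat) : finType :=
  {i : 'I_(size la) & 'I_(nth 0%N la i)}.

Definition cell_row (la : seq nat) (c : cell la) : nat := tag c.
Definition cell_col (la : seq nat) (c : cell la) : nat := tagged c.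

Definition semistandard (n : nat) (la : seq nat)
    (t : {ffun cell la -> 'I_n}) : bool :=
  [forall c, forall d,
     ((cell_row c == cell_row d) && (cell_col c < cell_col d)%N
        ==> (t c <= t d)%N)
  && ((cell_col c == cell_col d) && (cell_row c < cell_row d)%N
        ==> (t c < t d)%N)].

Definition schur (n : nat) (la : seq nat) : {mpoly int[n]} :=
  \sum_(t : {ffun cell la -> 'I_n} | semistandard t) \prod_c 'X_(t c).

Definition contained (mu la : seq nat) : Prop :=
  forall i : nat, (nth 0%N mu i <= nth 0%N la i)%N.

Definition vertical_strip (mu la : seq nat) : Prop :=
  contained mu la /\ forall i : nat, (nth 0%N la i - nth 0%N mu i <= 1)%N.

Definition UD (n w : nat) (mu nu : seq nat) :
    set ((2 * n).+1.-tuple (seq nat)) :=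
  [set T : (2 * n).+1.-tuple (seq nat) |
    [/\ nth [::] T 0 = mu,
        nth [::] T (2 * n) = nu,
        forall i, (i <= 2 * n)%N ->
          is_partition (nth [::] T i) /\ (size (nth [::] T i) <= w)%N
      & forall i, (i < n)%N ->
          vertical_strip (nth [::] T (2 * i)) (nth [::] T (2 * i).+1) /\
          vertical_strip (nth [::] T (2 * i).+2) (nth [::] T (2 * i).+1)]].

Definition MUD (n w : nat) (mu nu : seq nat) :
    set ((2 * n).+1.-tuple (seq nat) * {set 'I_n}) :=
  [set TS | UD w mu nu TS.1].

(* The variables are indexed from 0. The subtraction is the one of nat: for T
   in UD it does not truncate, see ud_expE below. *)
Definition ud_exp (n : nat) (T : (2 * n).+1.-tuple (seq nat)) (i : nat) : nat :=
  (2 * sumn (nth [::] T (2 * i).+1)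
   - (sumn (nth [::] T (2 * i)) + sumn (nth [::] T (2 * i).+2)))%N.

Definition ud_weight (n : nat) (T : (2 * n).+1.-tuple (seq nat)) :
    {mpoly int[n]} :=
  \prod_(i < n) 'X_i ^+ ud_exp T i.

Definition set_weight (n : nat) (S : {set 'I_n}) : {mpoly int[n]} :=
  \prod_(j in S) 'X_j.

(* The remaining facts show that ud_exp is the intended integer exponent and
   that the finitely supported sums over partitions with bounded first part
   and over MUD are genuine sums: both supports are finite. *)

Lemma contained_sumn (mu la : seq nat) :
  contained mu la -> (sumn mu <= sumn la)%N.
Proof.
elim: mu la => [|a mu IH] [|b la] h //=.
- have h' : contained mu [::] by move=> i; have := h i.+1; rewrite !nth_nil.
  by have := h 0%N; have := IH [::] h'; rewrite /=; lia.
- by have := h 0%N; have := IH la (fun i => h i.+1); rewrite /=; lia.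
Qed.

Lemma ud_expE (n w : nat) (mu nu : seq nat) T (i : nat) :
  UD (n := n) w mu nu T -> (i < n)%N ->
  (ud_exp T i : int) = - (sumn (nth [::] T (2 * i)) : int)
                       + 2 * (sumn (nth [::] T (2 * i).+1) : int)
                       - (sumn (nth [::] T (2 * i).+2) : int).
Proof.
move=> [_ _ _ h] /h [[/contained_sumn + _] [/contained_sumn + _]].
by rewrite /ud_exp; lia.
Qed.

Lemma schur_eq0 (n : nat) (la : seq nat) :
  is_partition la -> (n < size la)%N -> schur n la = 0.
Proof.
move=> /andP[_ la0] nla; rewrite /schur big_pred0 // => t.
apply/negP => /forallP st.
have c0 (i : 'I_(size la)) : (0 < nth 0 la i)%N.
  by rewrite lt0n; apply: contraNneq la0 => <-; exact: mem_nth.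
pose c i : cell la := Tagged (fun i : 'I_(size la) => 'I_(nth 0%N la i))
                             (Ordinal (c0 i)).
have inc (i j : 'I_(size la)) : (i < j)%N -> (t (c i) < t (c j))%N.
  by move=> ij; have /forallP/(_ (c j))/andP[_] := st (c i);
     rewrite /cell_col /cell_row /= ij.
have tinj : injective (fun i => t (c i)).
  move=> i j /(congr1 val) /= e.
  by case: (ltngtP i j) => [/inc|/inc|/val_inj //]; rewrite e ltnn.
by have := leq_card _ tinj; rewrite !card_ord leqNgt nla.
Qed.

Lemma finite_box (a b : nat) :
  finite_set [set la : seq nat | (size la <= a)%N /\ all (leq^~ b) la].
Proof.
pose f (s : a.-bseq 'I_b.+1) : seq nat := map val s.
apply: (@sub_finite_set _ _ [set f s | s in setT]); last first.
  by apply: finite_image; exact: finite_finset.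
move=> la /= [sa lb].
have sz : (size (map (@inord b) la) <= a)%N by rewrite size_map.
exists (Bseq sz) => //; rewrite /f /= -map_comp -[RHS]map_id.
by apply/eq_in_map => x /(allP lb) xb /=; rewrite inordK.
Qed.

Lemma finite_schur_support (n m k : nat) :
  finite_set ([set la | [/\ is_partition la, (head 0 la <= m)%N
                          & odd_rows la = k]]
              `&` schur n @^-1` [set~ 0]).
Proof.
apply: sub_finite_set (finite_box n m) => la /= [[pla hla _] sla]; split.
  by rewrite leqNgt; apply/negP => /(schur_eq0 pla).
case: la pla hla {sla} => [//|a la] /andP[pa _] am.
have tr : transitive geq by move=> x y z yx xz; exact: leq_trans xz yx.
have /allP h : all (geq a) la := order_path_min tr pa.
by apply/allP => x; rewrite inE => /predU1P[->//|/h xa]; exact: leq_trans xa am.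
Qed.

Lemma finite_UD (n w : nat) (mu nu : seq nat) :
  finite_set (@UD n w mu nu).
Proof.
pose b := (sumn mu + n)%N.
have box T : @UD n w mu nu T -> forall i, (i <= 2 * n)%N ->
    (size (nth [::] T i) <= w)%N /\ all (leq^~ b) (nth [::] T i).
  move=> [T0 _ Tw Ts] i ile; split; first by have [] := Tw i ile.
  have mub j : (nth 0 mu j <= sumn mu)%N.
    elim: mu {T0 b} j => [|x s IH] [|j] //=; first exact: leq_addr.
    by rewrite (leq_trans (IH j)) ?leq_addl.
  have ev m j : (m <= n)%N -> (nth 0 (nth [::] T (2 * m)) j <= sumn mu + m)%N.
    elim: m => [|m IH] mn; first by rewrite muln0 T0 addn0.
    have [[h1 h2] [h3 h4]] := Ts m mn.
    have -> : (2 * m.+1 = (2 * m).+2)%N by lia.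
    by move: (h1 j) (h2 j) (h3 j) (IH (ltnW mn)); lia.
  apply/(all_nthP 0%N) => j _; rewrite /b /=.
  have [m [im|im]] : exists m, i = (2 * m)%N \/ i = (2 * m).+1.
    by exists i./2; lia.
  - have mn : (m <= n)%N by lia.
    by rewrite im; move: (ev m j mn); lia.
  - have mn : (m < n)%N by lia.
    have [[h1 h2] _] := Ts m mn; rewrite im.
    by move: (h1 j) (h2 j) (ev m j (ltnW mn)); lia.
pose B := bseq_of w 'I_b.+1.
pose f (s : {ffun 'I_(2 * n).+1 -> B}) : (2 * n).+1.-tuple (seq nat) :=
  [tuple map val (s i) | i < (2 * n).+1].
apply: (@sub_finite_set _ _ [set f s | s in setT]); last first.
  by apply: finite_image; exact: finite_finset.
move=> T /box bT /=.
have ex (i : 'I_(2 * n).+1) : exists s : B, map val s = tnth T i :> seq nat.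
  have [sw sb] := bT i (ltn_ord i).
  have sz : (size (map (@inord b) (nth [::] T i)) <= w)%N by rewrite size_map.
  exists (Bseq sz); rewrite (tnth_nth [::]) /= -map_comp -[RHS]map_id.
  by apply/eq_in_map => x /(allP sb) xb /=; rewrite inordK.
have [g gP] := choice ex.
exists (finfun g) => //; apply: eq_from_tnth => i.
by rewrite tnth_mktuple ffunE gP.
Qed.

Lemma finite_MUD (n w : nat) (mu nu : seq nat) :
  finite_set (@MUD n w mu nu).
Proof.
apply: (@sub_finite_set _ _ (@UD n w mu nu `*` setT)) => [TS h|]; first by split.
by apply: finite_setX; [exact: finite_UD | exact: finite_finset].
Qed.

(* Main.v *)
Require Import Defs.
From mathcomp Require Import all_boot all_order all_algebra.
From mathcomp Require Import boolp classical_sets cardinality fsbigop.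
From mathcomp Require Import mpoly.
From mathcomp Require Import perm zify ring.

Set Implicit Arguments.
Unset Strict Implicit.
Unset Printing Implicit Defensive.

Import Order.TTheory GRing.Theory Num.Theory.

Local Open Scope ring_scope.

(** Encode a shape by its columns: a semistandard tableau is then a walk of
    non-colliding particles, each letter moving some of them up by one, so that
    such walks are counted by determinants of one-particle weights.

    Removing a cell from each odd row of a shape gives a shape with even rows,
    i.e. with columns equal in pairs, so the Pieri rule for the elementary
    symmetric polynomials turns the left-hand side into [e_k] times the sum over
    shapes with even rows and at most [2 w] columns.  The Pieri rule itself
    follows from a local identity that factors over the columns.

    Summing the determinants over configurations of [w] adjacent pairs gives a
    Pfaffian of the antisymmetric Toeplitz matrix [c (j - i + 1) - c (j - i - 1)],
    where [c d] is the weight of the up-down walks of one particle with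
    displacement [d].  In the basis of symmetric and antisymmetric vectors it
    reduces to [det (c (b - a) - c (a + b))], which by reflection at a wall
    counts the up-down walks of [w] particles, i.e. the up-down tableaux.  The
    constants are not tracked: they do not depend on the variables, and both
    sides are 1 when there are none. *)

(** Determinants know nothing of the constraint [good]. Every determinantal identity below therefore
    needs the determinant to vanish by itself at configurations just outside the constraint, through
    two equal columns (a collision) or a zero column (the wall), where the walk count vanishes by
    definition. On the Schur side the particles are columns; in the up-down walks they are rows, so
    that a vertical strip is a move of each particle by at most one. A marker [t] for removed cells
    treats all numbers of odd rows at once: a shape with at most [2 * w + 1] columns determines its
    even-row core with at most [2 * w] columns, and [t] counts the cells of the difference. The
    number [k] is recovered as a coefficient. The Pfaffian is an unnormalised sum over all
    permutations for a matrix that need not be antisymmetric. The minor summation then makes sense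
    over every commutative ring; the price is factors 2 and w factorial, cancelled only at the end,
    in a domain of characteristic 0. *)

(** * Non-colliding walks and determinants of one-particle functions *)

Section Walks.
Variables (R : comNzRingType) (N : nat).
Implicit Types (q k : {ffun 'I_N -> int}) (e : {ffun 'I_N -> bool}).
Implicit Types (f g : {ffun 'I_N -> int} -> R) (l : seq (int * R)).

(** The entries are integers rather than naturals so that predecessors outside the constraint can be
    written down before they are discarded. *)
Definition good q : bool :=
  [forall i : 'I_N, (0 <= q i) && [forall j : 'I_N, (i <= j)%N ==> (q j <= q i)]].

Lemma goodP q :
  reflect ((forall i, 0 <= q i) /\ (forall i j : 'I_N, (i <= j)%N -> q j <= q i))
          (good q).
Proof.
apply: (iffP forallP) => [h|[h1 h2] i].
  split=> [i|i j ij]; first by have /andP[] := h i.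
  by have /andP[_ /forallP/(_ j)] := h i; rewrite ij.
by rewrite h1; apply/forallP => j; apply/implyP => /h2.
Qed.

Lemma good0 : good 0.
Proof. by apply/goodP; split=> *; rewrite !ffunE. Qed.

Definition shift (s : int) e q : {ffun 'I_N -> int} :=
  [ffun j => q j + if e j then s else 0].

Lemma shiftK (s : int) e : cancel (shift s e) (shift (- s) e).
Proof. by move=> q; apply/ffunP => j; rewrite !ffunE; case: (e j); ring. Qed.

Definition delta q : {ffun 'I_N -> int} -> R := fun k => (k == q)%:R.

(** Read forward from [k]: each particle that moves by [sx.1] costs [sx.2]. Hence [walk l f k] sums
    [f] over the ends of the good paths from [k] whose first move is the head of [l]. *)
Definition step (sx : int * R) f : {ffun 'I_N -> int} -> R :=
  fun k => \sum_(e : {ffun 'I_N -> bool}) sx.2 ^+ (\sum_j e j)%N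
             * ((good (shift sx.1 e k))%:R * f (shift sx.1 e k)).

Definition walk l f := foldr step f l.

Lemma walk_cons sx l f : walk (sx :: l) f = step sx (walk l f).
Proof. by []. Qed.

Lemma walk_rcons l sx f : walk (rcons l sx) f = walk l (step sx f).
Proof. by rewrite /walk foldr_rcons. Qed.

Lemma eq_walk l f g : f =1 g -> walk l f =1 walk l g.
Proof.
move=> fg; elim: l => [//|sx l IH] k; rewrite !walk_cons.
by apply: eq_bigr => e _; rewrite IH.
Qed.

Lemma walk_sum (I : finType) (P : pred I) (c : I -> R) l
    (F : I -> {ffun 'I_N -> int} -> R) k :
  walk l (fun q => \sum_(i | P i) c i * F i q) k
  = \sum_(i | P i) c i * walk l (F i) k.
Proof.
elim: l k => [//|sx l IH] k; rewrite walk_cons /step.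
under eq_bigr => e _ do rewrite IH !big_distrr /=.
rewrite exchange_big /=; apply: eq_bigr => i _; rewrite big_distrr /=.
by apply: eq_bigr => e _; ring.
Qed.

(** A move raises a particle by at most 1, so the functions are compared only on a finite box. This
    lets families of final shapes be indexed by finite types. *)
Lemma eq_walk_good l f g (m : nat) k :
    all (fun sx : int * R => sx.1 <= 1) l -> good k -> (forall i, k i <= m%:Z) ->
    (forall q, good q -> (forall i, q i <= (m + size l)%N%:Z) -> f q = g q) ->
  walk l f k = walk l g k.
Proof.
elim: l m k => [|sx l IH] m k hl gk km fg; first by apply: fg => //; rewrite addn0.
case/andP: hl => h hl.
apply: eq_bigr => e _; case: (boolP (good _)) => [gs|_]; last by rewrite !mul0r.
congr (_ * (_ * _)); apply: (IH m.+1) => //.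
- by move=> i; rewrite ffunE; have := km i; case: (e i); lia.
- by move=> q gq qm; apply: fg => //; rewrite /= addnS -addSn.
Qed.

Lemma walk_bad l q k : good k -> ~~ good q -> walk l (delta q) k = 0.
Proof.
elim: l k => [|sx l IH] k gk bq.
  by rewrite /= /delta; case: eqP => // kq; rewrite -kq gk in bq.
rewrite walk_cons /step big1 // => e _; case: (boolP (good _)) => [gs|_].
  by rewrite IH // !mulr0.
by rewrite mul0r mulr0.
Qed.

Lemma step_delta sx q k : good q ->
  step sx (delta q) k
  = \sum_(e : {ffun 'I_N -> bool}) sx.2 ^+ (\sum_j e j)%N * delta (shift (- sx.1) e q) k.
Proof.
move=> gq; apply: eq_bigr => e _; congr (_ * _); rewrite /delta.
have -> : (k == shift (- sx.1) e q) = (shift sx.1 e k == q).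
  apply/eqP/eqP => [->|<-]; last by rewrite shiftK.
  by have := shiftK (- sx.1) e q; rewrite opprK.
by case: eqP => [->|]; rewrite ?gq ?mulr1 ?mulr0.
Qed.

(** Decomposition by the last move. The predecessors are not filtered by [good], since [walk_bad]
    gives the others weight 0; this matches the expansion of a determinant along its columns term by
    term. *)
Lemma walk_rcons_delta l sx q : good q ->
  walk (rcons l sx) (delta q) 0
  = \sum_(e : {ffun 'I_N -> bool}) sx.2 ^+ (\sum_j e j)%N * walk l (delta (shift (- sx.1) e q)) 0.
Proof.
move=> gq; rewrite walk_rcons.
rewrite (eq_walk _ (fun k => step_delta sx k gq)).
exact: (walk_sum predT (fun e => sx.2 ^+ (\sum_j e j)%N) l
  (fun e => delta (shift (- sx.1) e q))).
Qed.

Lemma det_add_cols (x : R) (A B : 'M[R]_N) :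
  \det (\matrix_(i, j) (A i j + x * B i j))
  = \sum_(e : {ffun 'I_N -> bool}) x ^+ (\sum_j e j)%N
      * \det (\matrix_(i, j) (if e j then B i j else A i j)).
Proof.
rewrite -det_tr [LHS]/determinant.
under [RHS]eq_bigr => e _ do rewrite -det_tr /determinant big_distrr /=.
rewrite exchange_big /=; apply: eq_bigr => s _.
under eq_bigr => i _ do rewrite !mxE.
transitivity ((-1) ^+ s * \prod_(i < N) \sum_(b : bool)
    (if b then x * B (s i) i else A (s i) i)).
  by congr (_ * _); apply: eq_bigr => i _; rewrite big_bool addrC.
rewrite (bigA_distr_bigA (fun i (b : bool) => if b then x * B (s i) i else A (s i) i)).
rewrite big_distrr /=; apply: eq_bigr => e _.
rewrite mulrCA; congr (_ * _); rewrite -prodrXr -big_split /=.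
by apply: eq_bigr => i _; rewrite !mxE; case: (e i); rewrite ?expr1 ?expr0 ?mul1r.
Qed.

(** The staircase makes weakly decreasing entries strictly decreasing and nonnegative ones positive:
    a collision is an equality of positions and the wall is position 0. *)
Definition pos q (j : 'I_N) : int := q j + (N - j)%N%:Z.

Definition slater (phi : 'I_N -> int -> R) q : R := \det (\matrix_(i, j) phi i (pos q j)).

Lemma det_eq_cols (phi : 'I_N -> int -> R) (p : 'I_N -> int) (j1 j2 : 'I_N) :
  j1 != j2 -> p j1 = p j2 -> \det (\matrix_(i, j) phi i (p j)) = 0.
Proof.
move=> j12 e; rewrite -det_tr; apply: (determinant_alternate j12) => i.
by rewrite !mxE e.
Qed.

Lemma det_zero_col (phi : 'I_N -> int -> R) (p : 'I_N -> int) (j : 'I_N) :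
  (forall i, phi i (p j) = 0) -> \det (\matrix_(i, j) phi i (p j)) = 0.
Proof.
move=> h; rewrite (expand_det_col _ j) big1 // => i _.
by rewrite mxE h mul0r.
Qed.

Lemma slater_shift (phi phi' : 'I_N -> int -> R) (s : int) (x : R) q :
  (forall i j, phi' i (pos q j) = phi i (pos q j) + x * phi i (pos q j - s)) ->
  slater phi' q = \sum_(e : {ffun 'I_N -> bool}) x ^+ (\sum_j e j)%N * slater phi (shift (- s) e q).
Proof.
move=> h; rewrite /slater.
pose A := \matrix_(i, j) phi i (pos q j) : 'M_N.
pose B := \matrix_(i, j) phi i (pos q j - s) : 'M_N.
transitivity (\det (\matrix_(i, j) (A i j + x * B i j))).
  by congr (\det _); apply/matrixP => i j; rewrite !mxE h.
rewrite det_add_cols; apply: eq_bigr => e _; congr (_ * \det _).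
apply/matrixP => i j; rewrite !mxE /pos ffunE.
by case: (e j) => /=; congr (phi i _); ring.
Qed.

Lemma good_adjacent q :
  (forall i j : 'I_N, j = i.+1 :> nat -> q j <= q i) ->
  (forall j : 'I_N, j.+1 = N -> 0 <= q j) -> good q.
Proof.
move=> h1 h2.
have h (d : nat) : forall i j : 'I_N, (j = i + d :> nat)%N -> q j <= q i.
  elim: d => [|d IH] i j ij; first by rewrite (_ : j = i) //; apply: val_inj; rewrite /= ij addn0.
  have kN : (i + d < N)%N by have := ltn_ord j; lia.
  apply: le_trans (IH i (Ordinal kN) _) => //.
  by apply: h1; rewrite ij addnS.
have hd (i j : 'I_N) : (i <= j)%N -> q j <= q i.
  by move=> ij; apply: (h (j - i)%N); rewrite subnKC.
apply/goodP; split=> // i.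
have kN : (N.-1 < N)%N by have := ltn_ord i; lia.
apply: le_trans (h2 (Ordinal kN) _) (hd _ _ _) => /=; have := ltn_ord i; lia.
Qed.

(* A one-step predecessor of a decreasing configuration can fail to be good
   only by having two particles at the same position or one at the wall 0. *)
Lemma slater_bad (phi : 'I_N -> int -> R) q :
  (forall i, phi i 0 = 0) -> (forall j, -1 <= q j) ->
  (forall i j : 'I_N, (i <= j)%N -> q j <= q i + 1) ->
  ~~ good q -> slater phi q = 0.
Proof.
move=> phi0 qm1 qd; apply: contraNeq => nz; apply: good_adjacent => [i j ij|j jN].
  rewrite leNgt; apply: contra nz => lt; apply/eqP.
  apply: (@det_eq_cols phi (pos q) i j); first by rewrite -val_eqE /=; lia.
  by have := qd i j; have := ltn_ord j; rewrite /pos; lia.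
rewrite leNgt; apply: contra nz => lt; apply/eqP.
apply: (@det_zero_col phi (pos q) j) => i.
by rewrite (_ : pos q j = 0) //; have := qm1 j; rewrite /pos; lia.
Qed.

(** The predecessors of a down move have nonnegative entries, so only collisions occur and nothing
    is asked of [phi] at the wall. *)
Lemma slater_bad_down (phi : 'I_N -> int -> R) q :
  (forall j, 0 <= q j) -> (forall i j : 'I_N, (i <= j)%N -> q j <= q i + 1) ->
  ~~ good q -> slater phi q = 0.
Proof.
move=> q0 qd; apply: contraNeq => nz; apply: good_adjacent => [i j ij|j jN] //.
rewrite leNgt; apply: contra nz => lt; apply/eqP.
apply: (@det_eq_cols phi (pos q) i j); first by rewrite -val_eqE /=; lia.
by have := qd i j; have := ltn_ord j; rewrite /pos; lia.
Qed.

Definition slater_sum l (phi : 'I_N -> int -> R) :=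
  forall q, good q -> walk l (delta q) 0 = slater phi q.

(** Expanding the columns of the new determinant gives one old determinant for each set of moved
    particles. Those of bad predecessors vanish by [slater_bad], as their walks do by [walk_bad]. *)
Lemma slater_sum_up l (x : R) (phi phi' : 'I_N -> int -> R) :
  (forall i, phi i 0 = 0) ->
  (forall i a, 0 < a -> phi' i a = phi i a + x * phi i (a - 1)) ->
  slater_sum l phi -> slater_sum (rcons l (1, x)) phi'.
Proof.
move=> phi0 phi'E IH q gq; have /goodP[q0 qd] := gq.
rewrite walk_rcons_delta // (slater_shift (s := 1) (x := x) (phi := phi)); last first.
  by move=> i j; apply: phi'E; have := q0 j; have := ltn_ord j; rewrite /pos; lia.
apply: eq_bigr => e _; congr (_ * _) => /=.
case: (boolP (good (shift (-1) e q))) => [/IH //|bq].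
rewrite walk_bad ?good0 // slater_bad // => [j|i j ij]; rewrite !ffunE.
  by have := q0 j; case: (e j); lia.
by have := qd i j ij; case: (e i); case: (e j); lia.
Qed.

Lemma slater_sum_down l (x : R) (phi phi' : 'I_N -> int -> R) :
  (forall i a, 0 < a -> phi' i a = phi i a + x * phi i (a + 1)) ->
  slater_sum l phi -> slater_sum (rcons l (-1, x)) phi'.
Proof.
move=> phi'E IH q gq; have /goodP[q0 qd] := gq.
rewrite walk_rcons_delta // (slater_shift (s := -1) (x := x) (phi := phi)); last first.
  move=> i j; rewrite opprK; apply: phi'E.
  by have := q0 j; have := ltn_ord j; rewrite /pos; lia.
apply: eq_bigr => e _; congr (_ * _) => /=.
case: (boolP (good (shift (- -1) e q))) => [/IH //|bq].
rewrite walk_bad ?good0 // slater_bad_down // => [j|i j ij]; rewrite !ffunE.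
  by have := q0 j; case: (e j); lia.
by have := qd i j ij; case: (e i); case: (e j); lia.
Qed.

Definition start (i : 'I_N) : int := (N - i)%N%:Z.

(** Only positive positions are constrained, because the reflected functions of the up-down walks
    also have a source at [- start i]. *)
Lemma slater_sum0 (phi : 'I_N -> int -> R) :
  (forall i a, 0 < a -> phi i a = (a == start i)%:R) -> slater_sum [::] phi.
Proof.
move=> phiE q gq; have /goodP[q0 qd] := gq.
have pos_gt0 j : 0 < pos q j by have := q0 j; have := ltn_ord j; rewrite /pos; lia.
rewrite /= /delta; have [<-|nq] := eqVneq 0 q.
  rewrite /slater (_ : \matrix_(i, j) _ = 1%:M) ?det1 //.
  apply/matrixP => i j; rewrite !mxE phiE /start /pos ffunE; last first.
    by have := ltn_ord j; lia.
  rewrite add0r eqz_nat -(inj_eq val_inj) /=.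
  by congr (_ *+ nat_of_bool _); have := ltn_ord j; have := ltn_ord i; lia.
have [N0|N0] := posnP N.
  by case/eqP: nq; apply/ffunP => i; exfalso; have := ltn_ord i; lia.
pose j0 := Ordinal N0.
have qj0 : 0 < q j0.
  rewrite lt0r q0 andbT; apply: contra nq => /eqP e; apply/eqP/ffunP => j.
  by apply/eqP; rewrite ffunE eq_le q0 -e qd.
(* The top particle of a nonzero good configuration lies above all starting positions. *)
symmetry; apply: (@det_zero_col phi (pos q) j0) => i; rewrite phiE //.
by case: eqP => //; rewrite /start /pos /= => e; exfalso; lia.
Qed.

End Walks.

(** * One-particle weights of up walks and of up-down walks *)

Section Kernel.
Variable R : comNzRingType.
Implicit Types (l : seq (int * R)) (xs : seq R).

(** The coefficient of z^d in the product of the Laurent polynomials 1 + x z^s over the moves (s, x)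
    of [l]: walks of one free particle, without a wall. *)
Fixpoint kernel l (d : int) : R :=
  if l is (s, x) :: l' then kernel l' d + x * kernel l' (d - s) else (d == 0)%:R.

Lemma kernel_rcons l s x d :
  kernel (rcons l (s, x)) d = kernel l d + x * kernel l (d - s).
Proof.
elim: l d => [//|[s' x'] l IH] d /=; rewrite !IH.
by rewrite [d - s - s']addrAC; ring.
Qed.

Definition ups xs : seq (int * R) := [seq (1, x) | x <- xs].
Definition updowns xs : seq (int * R) := flatten [seq [:: (1, x); (-1, x)] | x <- xs].

Lemma kernel_ups_lt0 xs d : d < 0 -> kernel (ups xs) d = 0.
Proof.
elim: xs d => [|x xs IH] d d0 /=; first by case: eqP => // d00; rewrite d00 in d0.
by rewrite !IH ?mulr0 ?addr0 //; lia.
Qed.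

Lemma kernel_updowns_opp xs d : kernel (updowns xs) (- d) = kernel (updowns xs) d.
Proof.
elim: xs d => [|x xs IH] d /=; first by rewrite oppr_eq0.
have h a b : a = - b -> kernel (updowns xs) a = kernel (updowns xs) b by move=> ->.
rewrite (h (- d - -1) (d - 1)); last by ring.
rewrite (h (- d - 1) (d - -1)); last by ring.
rewrite (h (- d - 1 - -1) (d - 1 - -1)); last by ring.
by rewrite IH; ring.
Qed.

(** Two up walks meeting at [a] form an up-down walk from [i] to [j] once the second is reversed.
    Every [a] of nonzero weight lies between [j] and [j + size xs], hence in the range of the
    sum. *)
Lemma kernel_updownsE xs (B : nat) (i j : int) :
  0 <= j -> j + (size xs)%:Z < B%:Z ->
  \sum_(a < B) kernel (ups xs) (a%:Z - i) * kernel (ups xs) (a%:Z - j)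
  = kernel (updowns xs) (j - i).
Proof.
elim: xs i j => [|x xs IH] i j j0 jB /=.
  have lt : (`|j| < B)%N by lia.
  have jE : (`|j|%N)%:Z = j by lia.
  rewrite (bigD1 (Ordinal lt)) //= big1 => [|a]; last first.
    rewrite -(inj_eq val_inj) /= => ne; rewrite (_ : (a%:Z - j == 0) = false) ?mulr0 //.
    by apply/negbTE; lia.
  by rewrite jE subrr eqxx mulr1 addr0.
have jB' : (j + 1 + (size xs)%:Z < B%:Z) by move: jB => /=; lia.
transitivity (\sum_(a < B) kernel (ups xs) (a%:Z - i) * kernel (ups xs) (a%:Z - j)
  + x * \sum_(a < B) kernel (ups xs) (a%:Z - i) * kernel (ups xs) (a%:Z - (j + 1))
  + x * \sum_(a < B) kernel (ups xs) (a%:Z - (i + 1)) * kernel (ups xs) (a%:Z - j)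
  + x ^+ 2 * \sum_(a < B) kernel (ups xs) (a%:Z - (i + 1))
      * kernel (ups xs) (a%:Z - (j + 1))).
  rewrite !big_distrr -!big_split /=; apply: eq_bigr => a _.
  by rewrite !opprD !addrA; ring.
rewrite !IH; [|lia..].
rewrite (_ : j - (i + 1) = j - i - 1); last by ring.
rewrite (_ : j + 1 - (i + 1) = j - i); last by ring.
rewrite (_ : j + 1 - i = j - i - -1); last by ring.
by rewrite (_ : j - i - 1 - -1 = j - i); [ring | ring].
Qed.

Lemma slater_sum_ups (N : nat) xs :
  slater_sum (ups xs) (fun (i : 'I_N) a => kernel (ups xs) (a - start i)).
Proof.
elim/last_ind: xs => [|xs x IH].
  by apply: slater_sum0 => i a a0 /=; rewrite subr_eq0.
rewrite {1}/ups map_rcons; apply: slater_sum_up IH => [i|i a a0].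
  by apply: kernel_ups_lt0; rewrite /start; have := ltn_ord i; lia.
by rewrite /ups map_rcons kernel_rcons addrAC.
Qed.

Lemma updowns_rcons xs x :
  updowns (rcons xs x) = rcons (rcons (updowns xs) (1, x)) (-1, x).
Proof. by rewrite /updowns map_rcons flatten_rcons -!cats1 -catA. Qed.

(** Reflection at position 0: the up-down kernel is even, so the difference is odd in [a] and
    vanishes at the wall, as the next up move requires. Right after that up move it need not vanish
    there, but the following down move does not ask for it. *)
Lemma slater_sum_updowns (N : nat) xs :
  slater_sum (updowns xs) (fun (i : 'I_N) a =>
    kernel (updowns xs) (a - start i) - kernel (updowns xs) (a + start i)).
Proof.
elim/last_ind: xs => [|xs x IH].
  apply: slater_sum0 => i a a0 /=; rewrite subr_eq0.
  rewrite [X in _ - X%:R](_ : _ = 0)%N ?subr0 //.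
  by rewrite (_ : (a + start i == 0) = false) // /start; apply/negbTE; lia.
rewrite {1}updowns_rcons.
apply: (@slater_sum_down _ _ _ _ (fun i a =>
  kernel (rcons (updowns xs) (1, x)) (a - start i)
  - kernel (rcons (updowns xs) (1, x)) (a + start i))).
  move=> i a _; rewrite updowns_rcons !(kernel_rcons _ (-1)) opprK.
  by rewrite [a - _ + 1]addrAC [a + _ + 1]addrAC; ring.
apply: slater_sum_up IH => [i|i a _].
  by rewrite sub0r add0r kernel_updowns_opp subrr.
by rewrite !kernel_rcons [a - 1 - _]addrAC [a - 1 + _]addrAC; ring.
Qed.

End Kernel.

(** * Unnormalised Pfaffians and their behaviour under congruence *)

Lemma mul_colsub (R : comNzRingType) (m n p b : nat) (A : 'M[R]_(m, n))
    (B : 'M[R]_(n, p)) (g : 'I_b -> 'I_p) :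
  colsub g (A *m B) = A *m colsub g B.
Proof. by apply/matrixP => i j; rewrite !mxE; apply: eq_bigr => k _; rewrite mxE. Qed.

Lemma det_mxsub (R : comNzRingType) (n : nat) (f h : 'I_n -> 'I_n)
    (fI : injective f) (hI : injective h) (M : 'M[R]_n) :
  \det (mxsub f h M) = (-1) ^+ perm fI * (-1) ^+ perm hI * \det M.
Proof.
have -> : mxsub f h M = row_perm (perm fI) (col_perm (perm hI) M).
  by apply/matrixP => i j; rewrite !mxE !permE.
rewrite row_permE col_permE !det_mulmx !det_perm odd_permV.
by rewrite [\det M * _]mulrC mulrA.
Qed.

Section PfaffianSum.
Variables (R : comNzRingType) (w : nat).
Implicit Types (L : 'M[R]_(w + w)).

(** A separate matrix for each pair allows the factors to be changed one at a time. *)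
Definition pfsum (Ls : 'I_w -> 'M[R]_(w + w)) : R :=
  \sum_(s : 'S_(w + w)) (-1) ^+ s * \prod_l Ls l (s (lshift w l)) (s (rshift w l)).

(* [pf L] is [2 ^ w * w`!] times the Pfaffian of the antisymmetric part
   [(L - L^T) / 2], up to the sign of a shuffle. *)
Definition pf L : R := pfsum (fun=> L).

Lemma eq_pfsum (Ls Ls' : 'I_w -> 'M[R]_(w + w)) : Ls =1 Ls' -> pfsum Ls = pfsum Ls'.
Proof.
move=> h; apply: eq_bigr => s _; congr (_ * _).
by apply: eq_bigr => l _; rewrite h.
Qed.

(** Minor summation: distributing the product over the inner sums chooses an index [g l] for each
    pair, and for fixed [g] the signed sum over permutations is the determinant of the chosen
    columns. *)
Lemma pf_mulmx_tr (b : nat) (A B : 'M[R]_(w + w, b)) :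
  pf (A *m B^T)
  = \sum_(g : {ffun 'I_w -> 'I_b}) \det (row_mx (colsub g A) (colsub g B)).
Proof.
under [RHS]eq_bigr => g _ do rewrite -det_tr /determinant.
rewrite exchange_big /=; apply: eq_bigr => s _; rewrite -big_distrr /=.
congr (_ * _).
under eq_bigr => l _ do rewrite mxE.
rewrite (bigA_distr_bigA (fun l k =>
  A (s (lshift w l)) k * B^T k (s (rshift w l)))) /=.
apply: eq_bigr => g _; rewrite big_split_ord /= -big_split /=.
have trE m n (M : 'M[R]_(m, n)) i j : M^T i j = M j i by rewrite mxE.
by apply: eq_bigr => l _; rewrite !trE row_mxEl row_mxEr !mxE.
Qed.

(** With [L] written as [L *m 1%:M^T], minor summation applies to both sides, and [T] factors out of
    each determinant. *)
Lemma pf_congr (T L : 'M[R]_(w + w)) : pf (T *m L *m T^T) = \det T * pf L.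
Proof.
have LE : L = L *m 1%:M^T by rewrite trmx1 mulmx1.
rewrite pf_mulmx_tr [in RHS]LE pf_mulmx_tr.
rewrite big_distrr; apply: eq_bigr => g _ /=.
by rewrite -det_mulmx mul_mx_row -!mul_colsub mulmx1.
Qed.

(** Composing the permutations with the transposition of the two ends of pair [k] transposes this
    factor alone and costs a sign. *)
Lemma pfsum_flip (k : 'I_w) (Ls Ls' : 'I_w -> 'M[R]_(w + w)) :
  Ls' k = - (Ls k)^T -> (forall l, l != k -> Ls' l = Ls l) ->
  pfsum Ls' = pfsum Ls.
Proof.
move=> e ne; pose t := tperm (lshift w k) (rshift w k).
have lr : lshift w k != rshift w k by rewrite -val_eqE /=; have := ltn_ord k; lia.
rewrite /pfsum (reindex_inj (@mulgI _ t)) /=; apply: eq_bigr => s _.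
rewrite odd_mul_tperm lr signr_addb expr1 mulN1r mulNr -mulrN; congr (_ * _).
rewrite (bigD1 k) //= [RHS](bigD1 k) //= e !mxE !permM tpermL tpermR mulNr opprK.
congr (_ * _); apply: eq_bigr => l lk; rewrite ne // !permM !tpermD //.
all: move: lk (ltn_ord l) (ltn_ord k); rewrite -!val_eqE /=; lia.
Qed.

Lemma pfsumD (k : 'I_w) (Ls1 Ls2 Ls : 'I_w -> 'M[R]_(w + w)) :
  Ls k = Ls1 k + Ls2 k ->
  (forall l, l != k -> Ls l = Ls1 l) -> (forall l, l != k -> Ls l = Ls2 l) ->
  pfsum Ls = pfsum Ls1 + pfsum Ls2.
Proof.
move=> e ne1 ne2; rewrite /pfsum -big_split /=; apply: eq_bigr => s _.
rewrite -mulrDr; congr (_ * _).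
rewrite (bigD1 k) //= [X in X + _](bigD1 k) //= [X in _ + X](bigD1 k) //= e mxE mulrDl.
congr (_ * _ + _ * _); apply: eq_bigr => l lk; first by rewrite ne1.
by rewrite ne2.
Qed.

Lemma pf_antisym L : pf (L - L^T) = (2 ^ w)%:R * pf L.
Proof.
(* The first [i] factors are antisymmetrised. One more doubles the sum, as by [pfsum_flip] the
   summand with [- L^T] equals the one with [L]. *)
pose Ls (i : nat) (l : 'I_w) := if (l < i)%N then L - L^T else L.
have h (i : nat) : (i <= w)%N -> pfsum (Ls i) = (2 ^ i)%:R * pf L.
  elim: i => [|i IH] iw; first by rewrite mul1r; apply: eq_pfsum => l.
  pose k := Ordinal iw.
  pose Ls' (l : 'I_w) := if l == k then - L^T else Ls i l.
  have lk (l : 'I_w) : l != k -> (l < i.+1)%N = (l < i)%N.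
    by rewrite -val_eqE /=; lia.
  rewrite (@pfsumD k (Ls i) Ls').
  - rewrite (@pfsum_flip k (Ls i) Ls').
    + by rewrite IH ?(ltnW iw) // expnS natrM -mulrA [2%:R * _]mulr_natl mulr2n.
    + by rewrite /Ls' eqxx /Ls ltnn.
    + by move=> l /negbTE lk'; rewrite /Ls' lk'.
  - by rewrite /Ls' eqxx /Ls ltnn ltnSn.
  - by move=> l /lk lk'; rewrite /Ls lk'.
  - by move=> l ne; rewrite /Ls' (negbTE ne) /Ls lk.
by rewrite -(h w) //; apply: eq_pfsum => l; rewrite /Ls ltn_ord.
Qed.

(** Its value is w factorial, one for each permutation [g]; below it matters only as a constant
    independent of [X]. *)
Definition pf_block_factor : R :=
  \sum_(g : {ffun 'I_w -> 'I_w}) \det (colsub g (1%:M : 'M[R]_w)) ^+ 2.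

Lemma pf_block (X : 'M[R]_w) :
  pf (block_mx 0 X 0 0) = pf_block_factor * \det X.
Proof.
have -> : block_mx 0 X 0 0 = col_mx X 0 *m (col_mx 0 1%:M)^T :> 'M[R]_(w + w).
  by rewrite tr_col_mx mul_col_row !mul0mx trmx0 mulmx0 trmx1 mulmx1.
rewrite pf_mulmx_tr big_distrl; apply: eq_bigr => g _ /=.
have colsubE (A B : 'M[R]_w) : colsub g (col_mx A B) = col_mx (colsub g A) (colsub g B).
  by apply/matrixP => i j; rewrite !mxE; case: split => k; rewrite mxE.
have colsub0 : colsub g (0 : 'M[R]_w) = 0 by apply/matrixP => i j; rewrite !mxE.
rewrite !colsubE colsub0 -block_mxEh det_ublock -[X in colsub g X]mulmx1.
by rewrite mul_colsub det_mulmx; ring.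
Qed.

End PfaffianSum.

(** * Symmetric sums over all maps and over strictly decreasing ones *)

Section SymmetricSum.
Variables (R : comNzRingType) (w b : nat).
Implicit Types (a : {ffun 'I_w -> 'I_b}).

Definition strictly_decreasing a : bool :=
  [forall i : 'I_w, forall j : 'I_w, (i < j)%N ==> (a j < a i)%N].

Lemma strictly_decreasingP a :
  reflect (forall i j : 'I_w, (i < j)%N -> (a j < a i)%N) (strictly_decreasing a).
Proof.
apply: (iffP forallP) => [h i j ij|h i]; last by apply/forallP => j; apply/implyP => /h.
by have /forallP/(_ j) := h i; rewrite ij.
Qed.

(** Exactly one permutation sorts an injective map: the inverse of the one sending an index to the
    number of larger values. *)
Lemma sum_sorting_perms a : injective a ->
  \sum_(s : 'S_w) (strictly_decreasing [ffun i => a (s i)])%:R = 1 :> R.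
Proof.
move=> aI.
pose rank (i : 'I_w) := #|[set j | (a i < a j)%N]|.
have rank_lt i : (rank i < w)%N.
  rewrite -[X in (_ < X)%N]card_ord -cardsT; apply/proper_card/properP.
  by split; [exact: finset.subsetT | exists i; rewrite !inE ?ltnn].
have rank_mono i j : (a i < a j)%N -> (rank j < rank i)%N.
  move=> ij; apply/proper_card/properP; split.
    by apply/fintype.subsetP => k; rewrite !inE; apply: ltn_trans.
  by exists j; rewrite !inE ?ltnn.
have rankI : injective (fun i => Ordinal (rank_lt i)).
  move=> i j [e]; apply: aI; apply: val_inj => /=.
  by case: (ltngtP (a i) (a j)) => // /rank_mono; rewrite e ltnn.
pose r := perm rankI.
rewrite (bigD1 (r^-1)%g) //= big1 => [|s sr].
  rewrite addr0 (_ : strictly_decreasing _) //.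
  apply/strictly_decreasingP => i j ij; rewrite !ffunE.
  have rE k : rank ((r^-1)%g k) = k :> nat.
    by have := permKV r k; rewrite {1}/r permE => /(congr1 val).
  case: (ltngtP (a ((r^-1)%g j)) (a ((r^-1)%g i))) => // [/rank_mono|/val_inj/aI/perm_inj e].
    by rewrite !rE; lia.
  by rewrite e ltnn in ij.
case: (boolP (strictly_decreasing _)) => // /strictly_decreasingP h.
case/eqP: sr; apply/permP => i.
have -> : s i = (r^-1)%g (r (s i)) by rewrite permK.
congr ((r^-1)%g _); apply: val_inj; rewrite /r permE /= /rank.
have h' (j k : 'I_w) : (a (s j) < a (s k))%N = (k < j)%N.
  have [kj|jk|/val_inj ->] := ltngtP k j; last by rewrite ltnn.
    by have := h _ _ kj; rewrite !ffunE.
  by apply/negbTE; rewrite -leqNgt; have := h _ _ jk; rewrite !ffunE => /ltnW.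
rewrite -(card_preimset _ (@perm_inj _ s)).
rewrite (_ : _ @^-1: _ = [set j : 'I_w | (j < i)%N]); last first.
  by apply/setP => j; rewrite !inE h'.
rewrite -sum1dep_card -(big_ord_widen w (fun=> 1%N)) ?sum1_card ?card_ord //.
exact: ltnW.
Qed.

(** Inserting the sum over sorting permutations, equal to 1 on injective maps, and exchanging sums
    leaves one copy of the sorted sum per permutation. *)
Lemma sum_symmetric (g : {ffun 'I_w -> 'I_b} -> R) :
  (forall a, ~ injective a -> g a = 0) ->
  (forall (s : 'S_w) a, g [ffun i => a (s i)] = g a) ->
  \sum_a g a = w`!%:R * \sum_(a | strictly_decreasing a) g a.
Proof.
move=> g0 gs.
transitivity (\sum_(a : {ffun 'I_w -> 'I_b}) \sum_(s : 'S_w)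
    (strictly_decreasing [ffun i => a (s i)])%:R * g [ffun i => a (s i)]).
  apply: eq_bigr => a _; under eq_bigr => s _ do rewrite gs.
  rewrite -big_distrl /=; have [/injectiveP aI|/injectiveP aI] := boolP (injectiveb a).
    by rewrite sum_sorting_perms // mul1r.
  by rewrite g0 ?mulr0.
rewrite exchange_big /= -card_Sn -sumr_const big_distrl /=.
apply: eq_bigr => s _; rewrite mul1r [RHS]big_mkcond /=.
pose h (r : 'S_w) a := [ffun i => a (r i)].
have hK r : cancel (h r) (h r^-1)%g.
  by move=> a; apply/ffunP => i; rewrite !ffunE permKV.
rewrite [RHS](reindex_inj (can_inj (hK s))) /=.
by apply: eq_bigr => a _; rewrite /h; case: ifP => _; rewrite ?mul1r ?mul0r.
Qed.

End SymmetricSum.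

(** * Shapes with even rows as configurations of adjacent pairs *)

Section PairedColumns.
Variable w : nat.

Definition paired (q : {ffun 'I_(w + w) -> int}) : bool :=
  [forall j : 'I_(w + w), forall k : 'I_(w + w), (j./2 == k./2) ==> (q j == q k)].

Lemma pairedP (q : {ffun 'I_(w + w) -> int}) :
  reflect (forall j k : 'I_(w + w), j./2 = k./2 -> q j = q k) (paired q).
Proof.
apply: (iffP forallP) => [h j k jk|h j].
  by have /forallP/(_ k) := h j; rewrite jk eqxx => /eqP.
by apply/forallP => k; apply/implyP => /eqP/h ->.
Qed.

Lemma half_ord_subproof (j : 'I_(w + w)) : (j./2 < w)%N.
Proof. by have := ltn_ord j; lia. Qed.
Definition half_ord j := Ordinal (half_ord_subproof j).

Lemma odd_ord_subproof (l : 'I_w) : (l.*2.+1 < w + w)%N.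
Proof. by have := ltn_ord l; lia. Qed.
Definition odd_ord l := Ordinal (odd_ord_subproof l).

(* The configuration whose particles occupy the positions [a l] and [a l + 1]. *)
Definition pair_config (B : nat) (a : {ffun 'I_w -> 'I_B}) : {ffun 'I_(w + w) -> int} :=
  [ffun j => (a (half_ord j))%:Z + (~~ odd j)%:Z - (w + w - j)%N%:Z].

Lemma pos_pair_config B (a : {ffun 'I_w -> 'I_B}) j :
  pos (pair_config a) j = (a (half_ord j))%:Z + (~~ odd j)%:Z.
Proof. by rewrite /pos ffunE subrK. Qed.

Lemma pair_config_inj B : injective (@pair_config B).
Proof.
move=> a a' e; apply/ffunP => l; apply: val_inj.
have := congr1 (fun q => pos q (odd_ord l)) e; rewrite !pos_pair_config.
have -> : half_ord (odd_ord l) = l by apply: val_inj => /=; lia.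
by move=> /addIr [].
Qed.

Lemma paired_pair_config B (a : {ffun 'I_w -> 'I_B}) : paired (pair_config a).
Proof.
apply/pairedP => j k jk; rewrite !ffunE.
have -> : half_ord j = half_ord k by apply: val_inj.
by have := ltn_ord j; have := ltn_ord k; lia.
Qed.

(** The value [a l] is the position of the lower particle of pair [l], entry plus staircase, hence
    less than [(w + w + m).+1]. *)
Lemma pair_config_surj (m : nat) (q : {ffun 'I_(w + w) -> int}) :
  good q -> paired q -> (forall i, q i <= m%:Z) ->
  exists2 a : {ffun 'I_w -> 'I_(w + w + m).+1}, strictly_decreasing a & pair_config a = q.
Proof.
move=> /goodP[q0 qd] /pairedP qp qm.
pose v (l : 'I_w) : nat := absz (q (odd_ord l) + (w + w - l.*2.+1)%N%:Z).
have vE l : (v l)%:Z = q (odd_ord l) + (w + w - l.*2.+1)%N%:Z.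
  by rewrite /v; have := q0 (odd_ord l); lia.
have vlt l : (v l < (w + w + m).+1)%N.
  by have := vE l; have := qm (odd_ord l); have := ltn_ord l; lia.
exists [ffun l => inord (v l)].
  apply/strictly_decreasingP => i j ij; rewrite !ffunE !inordK //.
  have := vE i; have := vE j; have := qd (odd_ord i) (odd_ord j).
  have := ltn_ord j; move=> /= jw h; have {}h := h (ltac:(lia)).
  by lia.
apply/ffunP => j; rewrite !ffunE inordK // vE.
rewrite (qp (odd_ord (half_ord j)) j) /=; last by lia.
by have := ltn_ord j; lia.
Qed.

Lemma walk_paired_sum (R : comNzRingType) (xs : seq R) :
  walk (ups xs) (fun q => (paired q)%:R) 0
  = \sum_(a : {ffun 'I_w -> 'I_(w + w + size xs).+1} | strictly_decreasing a)
      walk (ups xs) (delta R (pair_config a)) 0.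
Proof.
transitivity (\sum_(a : {ffun 'I_w -> 'I_(w + w + size xs).+1} | strictly_decreasing a)
  1 * walk (ups xs) (delta R (pair_config a)) 0); last first.
  by apply: eq_bigr => a _; rewrite mul1r.
rewrite -walk_sum; apply: (@eq_walk_good _ _ _ _ _ 0).
- by rewrite all_map; apply/allP.
- exact: good0.
- by move=> i; rewrite ffunE.
move=> q gq; rewrite add0n size_map => qm.
have [pq|npq] := boolP (paired q); last first.
  rewrite big1 // => a _; rewrite /delta mul1r; case: eqP => // e.
  by rewrite e paired_pair_config in npq.
have [a da aq] := pair_config_surj gq pq qm.
rewrite (bigD1 a) //= big1 => [|a' /andP[_ ne]]; first by rewrite /delta aq eqxx !mul1r addr0.
by rewrite /delta -aq (inj_eq (@pair_config_inj _)) eq_sym (negbTE ne) mulr0.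
Qed.

(** The configuration may be bad: pairs whose [a] differ by 1 share a position, and the lowest pair
    may reach 0. Then both sides vanish, the determinant by two equal columns or by a zero one, as
    up walks start at positive positions. *)
Lemma walk_pair_config (R : comNzRingType) (xs : seq R) B (a : {ffun 'I_w -> 'I_B}) :
  strictly_decreasing a ->
  walk (ups xs) (delta R (pair_config a)) 0
  = slater (fun i p => kernel (ups xs) (p - start i)) (pair_config a).
Proof.
move=> /strictly_decreasingP da.
case: (boolP (good (pair_config a))) => [/slater_sum_ups //|bq].
rewrite walk_bad ?good0 //; symmetry; move: bq; apply: contraNeq => nz.
have posE (q : {ffun 'I_(w + w) -> int}) j : q j = pos q j - (w + w - j)%N%:Z.
  by rewrite /pos addrK.
apply: good_adjacent => [i j ij|j jN]; rewrite leNgt; apply: contra nz => lt; apply/eqP.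
  move: lt; rewrite !posE !pos_pair_config => lt.
  have jw := ltn_ord j.
  have [oi|ei] := boolP (odd i); last first.
    have e : half_ord j = half_ord i by apply: val_inj => /=; lia.
    by rewrite e ei in lt; lia.
  have h : (a (half_ord j) < a (half_ord i))%N by apply: da => /=; lia.
  apply: (@det_eq_cols _ _ _ _ i j); first by rewrite -val_eqE /=; lia.
  by rewrite !pos_pair_config; lia.
apply: (@det_zero_col _ _ _ _ j) => i; apply: kernel_ups_lt0.
have lt' : pos (pair_config a) j <= 0 by rewrite /pos; lia.
by have := ltn_ord i; rewrite /start; lia.
Qed.

End PairedColumns.

(** * From the Pfaffian to the determinant of up-down walks *)

Section EvenColumnsUpDown.
Variables (w : nat).

Lemma deal_subproof (j : 'I_(w + w)) :
  ((if (j < w)%N then j.*2 else (j - w).*2.+1) < w + w)%N.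
Proof. by have := ltn_ord j; case: ifP; lia. Qed.
(** Puts the upper particles of all pairs before the lower ones, so that the columns form two blocks
    indexed by pairs. *)
Definition deal j := Ordinal (deal_subproof j).

Lemma deal_inj : injective deal.
Proof.
move=> i j /(congr1 val) /= e; apply: val_inj => /=; move: e.
by have := ltn_ord i; have := ltn_ord j; case: ifP; case: ifP; lia.
Qed.

Lemma fold_subproof (j : 'I_(w + w)) :
  ((if (j < w)%N then w.-1 - j else j) < w + w)%N.
Proof. by have := ltn_ord j; case: ifP; lia. Qed.
(** Orders the starting positions as [w + 1 + b], then [w - b]: rows [b] of the two blocks are
    mirror images about the centre w + 1/2. *)
Definition fold j := Ordinal (fold_subproof j).

Lemma fold_inj : injective fold.
Proof.
move=> i j /(congr1 val) /= e; apply: val_inj => /=; move: e.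
by have := ltn_ord i; have := ltn_ord j; case: ifP; case: ifP; lia.
Qed.

Lemma start_fold_lshift (b : 'I_w) : start (fold (lshift w b)) = w%:Z + 1 + b%:Z.
Proof. by rewrite /start /= ltn_ord; have := ltn_ord b; lia. Qed.

Lemma start_fold_rshift (b : 'I_w) : start (fold (rshift w b)) = w%:Z - b%:Z.
Proof. by rewrite /start /= ltnNge leq_addr /=; have := ltn_ord b; lia. Qed.

Lemma pos_deal_lshift B (a : {ffun 'I_w -> 'I_B}) (l : 'I_w) :
  pos (pair_config a) (deal (lshift w l)) = (a l)%:Z + 1.
Proof.
rewrite pos_pair_config (_ : half_ord _ = l); last by apply: val_inj; rewrite /= ltn_ord doubleK.
by rewrite /= ltn_ord odd_double.
Qed.

Lemma pos_deal_rshift B (a : {ffun 'I_w -> 'I_B}) (l : 'I_w) :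
  pos (pair_config a) (deal (rshift w l)) = (a l)%:Z.
Proof.
rewrite pos_pair_config (_ : half_ord _ = l); last first.
  by apply: val_inj; rewrite /= ltnNge leq_addr /=; lia.
by rewrite /= ltnNge leq_addr /= odd_double addr0.
Qed.

Section CommRing.
Variable R : comNzRingType.
Implicit Types xs : seq R.

Definition deal_sign : R := (-1) ^+ perm fold_inj * (-1) ^+ perm deal_inj.

Lemma deal_sign_sq : deal_sign * deal_sign = 1.
Proof.
by rewrite /deal_sign mulrACA -!expr2 !sqrr_sign mulr1.
Qed.

Definition hi_mx xs B : 'M[R]_(w + w, B) :=
  \matrix_(i, k) kernel (ups xs) (k%:Z + 1 - start (fold i)).
Definition lo_mx xs B : 'M[R]_(w + w, B) :=
  \matrix_(i, k) kernel (ups xs) (k%:Z - start (fold i)).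

Definition pair_det xs B (a : {ffun 'I_w -> 'I_B}) : R :=
  \det (row_mx (colsub a (hi_mx xs B)) (colsub a (lo_mx xs B))).

Lemma slater_pair_config xs B (a : {ffun 'I_w -> 'I_B}) :
  slater (fun i p => kernel (ups xs) (p - start i)) (pair_config a)
  = deal_sign * pair_det xs a.
Proof.
rewrite /pair_det; set M := row_mx _ _.
have -> : M = mxsub fold deal (\matrix_(i, j)
    kernel (ups xs) (pos (pair_config a) j - start i)).
  apply/matrixP => i j; rewrite [RHS]mxE mxE -[j]splitK.
  case: (split j) => l /=.
    by rewrite row_mxEl !mxE pos_deal_lshift.
  by rewrite row_mxEr !mxE pos_deal_rshift.
by rewrite (det_mxsub fold_inj deal_inj) -/deal_sign mulrA deal_sign_sq mul1r.
Qed.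

Lemma pair_det_noninj xs B (a : {ffun 'I_w -> 'I_B}) :
  ~ injective a -> pair_det xs a = 0.
Proof.
move=> /injectiveP /injectivePn[i [j ij aij]]; rewrite /pair_det -det_tr.
apply: (@determinant_alternate _ _ _ (lshift w i) (lshift w j)).
  by rewrite (inj_eq (@lshift_inj _ _)).
by move=> k; rewrite ![_^T _ _]mxE !row_mxEl !mxE aij.
Qed.

(** Both blocks of columns undergo the same permutation, so its sign appears squared. *)
Lemma pair_det_perm xs B (s : 'S_w) (a : {ffun 'I_w -> 'I_B}) :
  pair_det xs [ffun i => a (s i)] = pair_det xs a.
Proof.
rewrite /pair_det; pose P := colsub s (1%:M : 'M[R]_w).
have colsubE (A : 'M[R]_(w + w, B)) : colsub [ffun i => a (s i)] A = colsub a A *m P.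
  by rewrite -mul_colsub mulmx1; apply/matrixP => i j; rewrite !mxE ffunE.
have detP : \det P * \det P = 1.
  have -> : P = col_perm s 1%:M by apply/matrixP => i j; rewrite !mxE.
  by rewrite col_permE mul1mx det_perm -expr2 sqrr_sign.
rewrite !colsubE; set A := colsub a _; set A' := colsub a _.
have -> : row_mx (A *m P) (A' *m P) = row_mx A A' *m block_mx P 0 0 P.
  by rewrite mul_row_block !mulmx0 addr0 add0r.
by rewrite det_mulmx det_ublock detP mulr1.
Qed.

(** The [+ 1] is the distance between the two particles of a pair: the walk goes up from
    [start (fold i)] to [a + 1] and down from [a] to [start (fold j)]. *)
Definition link_mx xs : 'M[R]_(w + w) :=
  \matrix_(i, j) kernel (updowns xs) (start (fold j) - start (fold i) + 1).

Lemma walk_paired_pf xs :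
  w`!%:R * walk (ups xs) (fun q => (@paired w q)%:R) 0 = deal_sign * pf (link_mx xs).
Proof.
rewrite walk_paired_sum.
under eq_bigr => a da do rewrite walk_pair_config // slater_pair_config.
rewrite -big_distrr /= mulrCA -sum_symmetric; last 2 first.
- by move=> a; apply: pair_det_noninj.
- by move=> s a; apply: pair_det_perm.
rewrite -pf_mulmx_tr; congr (_ * pf _).
apply/matrixP => i j; rewrite !mxE.
transitivity (\sum_(a < (w + w + size xs).+1)
    kernel (ups xs) (a%:Z - (start (fold i) - 1)) * kernel (ups xs) (a%:Z - start (fold j))).
  by apply: eq_bigr => a _; rewrite !mxE; congr (kernel _ _ * _); ring.
rewrite kernel_updownsE; first by congr (kernel _ _); ring.
  by rewrite /start.
by rewrite /start /=; have := ltn_ord (fold j); lia.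
Qed.

Definition sym_mx : 'M[R]_(w + w) := block_mx 1%:M 1%:M 1%:M (- 1%:M).

Lemma sym_mx_sq : sym_mx *m sym_mx = 2%:R%:M.
Proof.
rewrite mulmx_block !mulmx1 !mul1mx mulNmx mulmxN mulmx1 opprK subrr.
by rewrite -!raddfD /= -scalar_mx_block.
Qed.

Lemma tr_sym_mx : sym_mx^T = sym_mx.
Proof.
rewrite /sym_mx tr_block_mx trmx1; congr block_mx.
by apply/matrixP => i j; rewrite !mxE eq_sym.
Qed.

Definition cross_mx xs : 'M[R]_w := \matrix_(a, b)
  (2%:R * (kernel (updowns xs) (b%:Z - a%:Z + 1) - kernel (updowns xs) (b%:Z - a%:Z - 1)
      + kernel (updowns xs) (a%:Z + b%:Z + 2) - kernel (updowns xs) (a%:Z + b%:Z))).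

(* In the basis of symmetric and antisymmetric combinations about the centre of
   the starting positions, the Toeplitz matrix [link_mx] has no diagonal blocks. *)
Lemma sym_link_mx xs :
  let Y := block_mx 0 (cross_mx xs) 0 0 in
  sym_mx *m (link_mx xs - (link_mx xs)^T) *m sym_mx^T = Y - Y^T.
Proof.
move=> Y; set c := kernel (updowns xs).
have cN d d' : d' = - d -> c d = c d' by move=> ->; rewrite /c kernel_updowns_opp.
pose q d := c (d + 1) - c (d - 1).
(* Reflecting the starting positions about their centre negates all differences, hence by oddness of
   [q] negates the matrix. It therefore pairs symmetric vectors only with antisymmetric ones. *)
have qN d d' : d' = - d -> q d = - q d'.
  move=> ->; rewrite /q (cN (d + 1) (- d - 1)) ?(cN (d - 1) (- d + 1)) ?opprB //; ring.
have -> : link_mx xs - (link_mx xs)^T = block_mx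
    (\matrix_(a, b) q (b%:Z - a%:Z)) (\matrix_(a, b) q (- 1 - b%:Z - a%:Z))
    (\matrix_(a, b) q (1 + b%:Z + a%:Z)) (\matrix_(a, b) q (a%:Z - b%:Z)).
  have linkE i j : (link_mx xs - (link_mx xs)^T) i j
      = q (start (fold j) - start (fold i)).
    rewrite !mxE /q -/c; congr (_ - _); apply: cN; ring.
  apply/matrixP => i j; rewrite linkE -[i]splitK -[j]splitK.
  case: (split i) => a; case: (split j) => b /=;
    rewrite ?block_mxEul ?block_mxEur ?block_mxEdl ?block_mxEdr mxE
      ?start_fold_lshift ?start_fold_rshift; congr (q _); ring.
rewrite tr_sym_mx /sym_mx /Y tr_block_mx !trmx0 opp_block_mx add_block_mx !mulmx_block.
rewrite !mul1mx !mulNmx !mul1mx !mulmxN !mulmx1.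
rewrite !oppr0 !addr0 !add0r.
have q1 (a b : 'I_w) : q (- 1 - b%:Z - a%:Z) = - q (1 + b%:Z + a%:Z) by apply: qN; ring.
have q2 (a b : 'I_w) : q (a%:Z - b%:Z) = - q (b%:Z - a%:Z) by apply: qN; ring.
have cE (a b : 'I_w) : cross_mx xs a b = 2%:R * (q (b%:Z - a%:Z) + q (1 + b%:Z + a%:Z)).
  rewrite mxE /q -/c (_ : 1 + b%:Z + a%:Z + 1 = a%:Z + b%:Z + 2); last by ring.
  by rewrite (_ : 1 + b%:Z + a%:Z - 1 = a%:Z + b%:Z); ring.
congr block_mx; apply/matrixP => a b.
- by rewrite !mxE q1 (q2 a b); ring.
- by rewrite cE !mxE q1 (q2 a b); ring.
- have -> : (- (cross_mx xs)^T) a b = - cross_mx xs b a.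
    by rewrite [LHS]mxE; congr (- _); rewrite [LHS]mxE.
  by rewrite cE !mxE q1 (q2 a b) [1 + a%:Z + b%:Z]addrAC; ring.
- by rewrite !mxE q1 (q2 a b); ring.
Qed.

Definition updown_mx xs : 'M[R]_w := \matrix_(a, b)
  (kernel (updowns xs) (b%:Z - a%:Z) - kernel (updowns xs) (a%:Z + b%:Z + 2)).

Lemma walk_updowns_det xs :
  walk (updowns xs) (delta R (0 : {ffun 'I_w -> int})) 0 = \det (updown_mx xs).
Proof.
rewrite slater_sum_updowns ?good0 //; symmetry.
have -> : updown_mx xs = mxsub (@rev_ord w) (@rev_ord w) (\matrix_(i, j)
   (kernel (updowns xs) (pos 0 j - start i) - kernel (updowns xs) (pos 0 j + start i))).
  apply/matrixP => a b; rewrite !mxE /pos /start ffunE /=.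
  by congr (kernel _ _ - kernel _ _); have := ltn_ord a; have := ltn_ord b; lia.
by rewrite (det_mxsub rev_ord_inj rev_ord_inj) -expr2 sqrr_sign mul1r.
Qed.

Definition down_mx : 'M[R]_w := \matrix_(i, j) (i == j.+1 :> nat)%:R.

Lemma sum_down (F : int -> R) (a : 'I_w) :
  F (-1) = 0 -> \sum_(j < w) (a == j.+1 :> nat)%:R * F j%:Z = F (a%:Z - 1).
Proof.
move=> F0; have [a0|a0] := posnP a.
  by rewrite big1 ?a0 // => j _; rewrite mul0r.
have lt : (a.-1 < w)%N by have := ltn_ord a; lia.
rewrite (bigD1 (Ordinal lt)) //= big1 => [|j]; last first.
  rewrite -val_eqE /= => ne.
  by rewrite (_ : (a == j.+1 :> nat) = false) ?mul0r //; apply/negbTE; lia.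
by rewrite prednK // eqxx mul1r addr0; congr (F _); lia.
Qed.

(** The entry D(a, b) of [updown_mx] vanishes at a = -1 and at b = -1 because the kernel is even, so
    the truncated shifts act as true shifts even in the first row and column. In D(a, b) - D(a - 1,
    b) + D(a, b - 1) - D(a - 1, b - 1) the terms at b - a and at a + b + 1 cancel. *)
Lemma cross_mxE xs :
  cross_mx xs = (- 2%:R) *: ((1%:M - down_mx) *m updown_mx xs *m (1%:M + down_mx^T)).
Proof.
set c := kernel (updowns xs).
pose D (a b : int) := c (b - a) - c (a + b + 2).
have D1 b : D (-1) b = 0.
  rewrite /D (_ : b - -1 = b + 1); last by ring.
  by rewrite (_ : -1 + b + 2 = b + 1) ?subrr //; ring.
have D2 a : D a (-1) = 0.
  rewrite /D (_ : a + -1 + 2 = a + 1); last by ring.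
  by rewrite (_ : -1 - a = - (a + 1)) ?[c _]kernel_updowns_opp ?subrr //; ring.
have DE : updown_mx xs = \matrix_(a, b) D a%:Z b%:Z by [].
have lE : down_mx *m updown_mx xs = \matrix_(a, b) D (a%:Z - 1) b%:Z.
  apply/matrixP => a b; rewrite DE !mxE -(sum_down (F := fun a => D a b%:Z)) //.
  by apply: eq_bigr => j _; rewrite !mxE.
have rE (F : int -> int -> R) : (forall a, F a (-1) = 0) ->
    (\matrix_(a, b) F a%:Z b%:Z) *m down_mx^T
    = \matrix_(a < w, b < w) F a%:Z (b%:Z - 1).
  move=> F0; apply/matrixP => a b; rewrite !mxE -(sum_down (F := F a%:Z)) //.
  by apply: eq_bigr => j _; rewrite !mxE mulrC.
rewrite mulmxBl mul1mx mulmxDr mulmx1 mulmxBl lE (rE (fun a b => D (a - 1) b)) //.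
rewrite DE rE //; apply/matrixP => a b; rewrite !mxE /D -/c.
have cN d d' : d' = - d -> c d = c d' by move=> ->; rewrite /c kernel_updowns_opp.
rewrite (_ : b%:Z - (a%:Z - 1) = b%:Z - a%:Z + 1); last by ring.
rewrite (_ : b%:Z - 1 - (a%:Z - 1) = b%:Z - a%:Z); last by ring.
rewrite (_ : b%:Z - 1 - a%:Z = b%:Z - a%:Z - 1); last by ring.
rewrite (_ : a%:Z - 1 + b%:Z + 2 = a%:Z + b%:Z + 1); last by ring.
rewrite (_ : a%:Z - 1 + (b%:Z - 1) + 2 = a%:Z + b%:Z); last by ring.
rewrite (_ : a%:Z + (b%:Z - 1) + 2 = a%:Z + b%:Z + 1); last by ring.
by ring.
Qed.

Lemma det_cross_mx : exists k : R, forall xs, \det (cross_mx xs) = k * \det (updown_mx xs).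
Proof.
exists ((- 2%:R) ^+ w * \det (1%:M - down_mx) * \det (1%:M + down_mx^T)) => xs.
by rewrite cross_mxE detZ !det_mulmx; ring.
Qed.

End CommRing.

(** The hypotheses on [R] serve to cancel [c1], which contains powers of 2, w factorial and the
    determinant of [sym_mx], a square root of twice the identity. *)
Lemma walk_paired (R : idomainType) (char0 : forall m, m.+1%:R != 0 :> R) (xs : seq R) :
  walk (ups xs) (fun q => (@paired w q)%:R) 0
  = walk (updowns xs) (delta R (0 : {ffun 'I_w -> int})) 0.
Proof.
have [k kE] := det_cross_mx R.
pose c1 : R := \det (sym_mx R) * (2 ^ w)%:R * deal_sign R * w`!%:R.
pose c2 : R := (2 ^ w)%:R * pf_block_factor R w * k.
have natr_neq0 m : (0 < m)%N -> m%:R != 0 :> R by case: m.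
have cE ys : c1 * walk (ups ys) (fun q => (@paired w q)%:R) 0
    = c2 * walk (updowns ys) (delta R (0 : {ffun 'I_w -> int})) 0.
  have -> : c1 * walk (ups ys) (fun q => (@paired w q)%:R) 0
      = \det (sym_mx R) * ((2 ^ w)%:R * (deal_sign R
          * (w`!%:R * walk (ups ys) (fun q => (@paired w q)%:R) 0))).
    by rewrite /c1; move: (deal_sign R) => s; rewrite !mulrA.
  rewrite walk_paired_pf [deal_sign R * (deal_sign R * _)]mulrA deal_sign_sq mul1r.
  rewrite -pf_antisym -pf_congr sym_link_mx pf_antisym pf_block kE walk_updowns_det.
  by rewrite /c2 !mulrA.
have c10 : c1 != 0.
  rewrite /c1 !mulf_neq0 ?natr_neq0 ?fact_gt0 ?expn_gt0 ?signr_eq0 //.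
  apply: contra_eq_neq (sym_mx_sq R) => d0.
  apply/eqP => /(congr1 determinant); rewrite det_mulmx d0 mul0r det_scalar => /esym/eqP.
  by rewrite expf_eq0 (negbTE (natr_neq0 2%N isT)) andbF.
have c12 : c1 = c2.
  have := cE [::]; rewrite /= /delta eqxx mulr1 (_ : paired 0) ?mulr1 //.
  by apply/pairedP => i j _; rewrite !ffunE.
by apply: (mulfI c10); rewrite cE c12.
Qed.

End EvenColumnsUpDown.

(** * The one-column identity behind the Pieri rule *)

Section LocalRule.
Variables (R : comNzRingType) (t x : R) (K m : nat -> int).
Hypotheses (K_dec : forall i, K i.+1 <= K i) (m_dec : forall i, m i.+1 <= m i).

(** Interlacing of column lengths at column [i], with [p'] the previous column of the smaller shape:
    at most one cell is added in each row. Column 0 has no upper bound. *)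
Definition strip_ok (q p : int) (i : nat) (p' : int) : bool :=
  (p <= q) && ((i == 0)%N || (q <= p')).

(** Column [i] of the two sides of a commutation relation: here [K] is raised by [b] and compared
    with [m], in [Mfac] it is [m] that is lowered by [b] and compared with [K]. *)
Definition Lfac i : R := \sum_(b : bool)
  x ^+ b * ((strip_ok (K i + b%:Z) (m i) i (m i.-1))%:R * t ^+ absz (K i + b%:Z - m i)%R).

Definition Mfac i : R := \sum_(b : bool)
  x ^+ b * (((K i.+1 <= m i - b%:Z) && (m i - b%:Z <= K i))%:R
            * t ^+ absz (K i - (m i - b%:Z))%R).

(** Such a contact blocks the raising of column [k] in [Lfac] and the lowering of column [k.-1] in
    [Mfac]. *)
Definition touch k : bool := (0 < k)%N && (K k == m k.-1).
Definition below k : bool := (k == 0)%N || (K k <= m k.-1).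

(** If [m k <= K k], a free move contributes [1 + t * x] and a blocked one 1, so the powers at the
    contacts complete both sides to the same product. Otherwise only [m k = K k + 1] gives a nonzero
    term, with [b = true] on both sides. *)
Lemma local_step k : below k ->
  (1 + t * x) ^+ touch k * Lfac k * (below k.+1)%:R = Mfac k * (1 + t * x) ^+ touch k.+1.
Proof.
move=> bk.
have mk : (k == 0)%N || (m k <= m k.-1) by case: (k) => //= k'; apply: m_dec.
have Kk := K_dec k.
have tk : touch k = (0 < k)%N && (K k == m k.-1) by [].
have tk1 : touch k.+1 = (K k.+1 == m k) by [].
have bk1 : below k.+1 = (K k.+1 <= m k) by [].
rewrite /below in bk.
pose A (b : bool) := strip_ok (K k + b%:Z) (m k) k (m k.-1).
pose B (b : bool) := (K k.+1 <= m k - b%:Z) && (m k - b%:Z <= K k).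
pose d := absz (K k - m k).
have [mK|Km] := leP (m k) (K k).
  have -> : Lfac k = t ^+ d * (1 + t * x) ^+ ~~ touch k.
    have A0 : A false by rewrite /A /strip_ok; lia.
    have A1 : A true = ~~ touch k by rewrite /A /strip_ok tk; lia.
    rewrite /Lfac big_bool -/(A true) -/(A false) A0 A1.
    rewrite (_ : absz (K k + true%:Z - m k)%R = d.+1); last by rewrite /d; lia.
    rewrite (_ : absz (K k + false%:Z - m k)%R = d); last by rewrite /d; lia.
    by case: (touch k); rewrite /= ?expr1 ?expr0 exprS; ring.
  have -> : Mfac k = (below k.+1)%:R * t ^+ d * (1 + t * x) ^+ ~~ touch k.+1.
    have B0 : B false = below k.+1 by rewrite /B bk1; lia.
    have B1 : B true = below k.+1 && ~~ touch k.+1 by rewrite /B bk1 tk1; lia.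
    rewrite /Mfac big_bool -/(B true) -/(B false) B0 B1.
    rewrite (_ : absz (K k - (m k - true%:Z))%R = d.+1); last by rewrite /d; lia.
    rewrite (_ : absz (K k - (m k - false%:Z))%R = d); last by rewrite /d; lia.
    by case: (below k.+1); case: (touch k.+1); rewrite /= ?expr1 ?expr0 exprS; ring.
  by case: (touch k); case: (touch k.+1); rewrite /= ?expr1 ?expr0; ring.
have -> : touch k = false by rewrite tk; lia.
have -> : touch k.+1 = false by rewrite tk1; lia.
have -> : below k.+1 = true by rewrite bk1; lia.
rewrite /Lfac /Mfac !big_bool -!/(A _) -!/(B _).
have -> : A false = false by rewrite /A /strip_ok; lia.
have -> : B false = false by rewrite /B; lia.
have -> : A true = (m k == K k + 1) by rewrite /A /strip_ok; lia.
have -> : B true = (m k == K k + 1) by rewrite /B; lia.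
case: eqP => [e|_]; last by rewrite /=; ring.
rewrite (_ : absz (K k + true%:Z - m k)%R = 0%N); last by lia.
rewrite (_ : absz (K k - (m k - true%:Z))%R = 0%N); last by lia.
by rewrite /=; ring.
Qed.

(** The contact factors telescope along the columns. The factor [below k] is there because the bound
    of [K k] by [m k.-1] is imposed by [Mfac] at [k.-1] but by [Lfac] only at [k]. *)
Lemma local_prod k :
  \prod_(i < k) Lfac i * (below k)%:R = \prod_(i < k) Mfac i * (1 + t * x) ^+ touch k.
Proof.
have belowM i : Mfac i * (below i.+1)%:R = Mfac i.
  rewrite /Mfac /below /=; case: leP => [|lt]; first by rewrite mulr1.
  rewrite mulr0 big1 // => b _.
  by rewrite (_ : (K i.+1 <= m i - b%:Z) = false) ?mul0r ?mulr0 //; case: b; lia.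
have prod_below j : \prod_(i < j) Mfac i * (below j)%:R = \prod_(i < j) Mfac i.
  by case: j => [|j]; rewrite ?mulr1 // big_ord_recr /= -mulrA belowM.
have belowL i : Lfac i * (below i)%:R = Lfac i.
  rewrite /Lfac /below; case: eqP => [_|i0] /=; first by rewrite mulr1.
  case: leP => [|lt]; first by rewrite mulr1.
  rewrite mulr0 big1 // => b _; rewrite /strip_ok (_ : (i == 0)%N = false) ?(introF eqP) //=.
  by rewrite (_ : (K i + b%:Z <= m i.-1) = false) ?andbF ?mul0r ?mulr0 //; case: b; lia.
elim: k => [|k IH]; first by rewrite !big_ord0.
rewrite !big_ord_recr /=.
rewrite -[Lfac k]belowL [Lfac k * _]mulrC !mulrA IH.
have [bk|nbk] := boolP (below k); last first.
  have p0 : \prod_(i < k) Mfac i = 0 by rewrite -prod_below (negbTE nbk) mulr0.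
  by rewrite p0 !mul0r.
by rewrite -!mulrA [(1 + t * x) ^+ _ * _]mulrA local_step.
Qed.

End LocalRule.

(** * The Pieri rule for elementary symmetric polynomials, for shapes extended by zero columns *)

Definition ext (n : nat) (q : {ffun 'I_n -> int}) (i : nat) : int :=
  oapp q 0 (insub i).

Lemma ext_ord n (q : {ffun 'I_n -> int}) (i : 'I_n) : ext q i = q i.
Proof. by rewrite /ext valK. Qed.

Lemma ext_lt n (q : {ffun 'I_n -> int}) i (lt : (i < n)%N) : ext q i = q (Ordinal lt).
Proof. by rewrite -ext_ord. Qed.

Lemma ext_ge n (q : {ffun 'I_n -> int}) i : (n <= i)%N -> ext q i = 0.
Proof. by move=> h; rewrite /ext insubF // ltnNge h. Qed.

Lemma ext_good n (q : {ffun 'I_n -> int}) i : good q -> 0 <= ext q i /\ ext q i.+1 <= ext q i.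
Proof.
move=> /goodP[q0 qd]; have [lt|ge] := ltnP i n; last by rewrite !ext_ge // ltnW.
rewrite ext_lt; split=> //; have [lt'|ge'] := ltnP i.+1 n; last by rewrite ext_ge.
by rewrite ext_lt; apply: qd.
Qed.

Lemma good_ext n (q : {ffun 'I_n -> int}) : (forall i, ext q i.+1 <= ext q i) -> good q.
Proof.
move=> h; apply: good_adjacent => [i j ij|j jn].
  by rewrite -!ext_ord ij.
by rewrite -ext_ord; have := h j; rewrite jn ext_ge.
Qed.

Lemma ext0 n i : ext (0 : {ffun 'I_n -> int}) i = 0.
Proof.
by have [lt|ge] := ltnP i n; [rewrite ext_lt ffunE | rewrite ext_ge].
Qed.

Lemma eq_walk_goodT (R : comNzRingType) n (l : seq (int * R)) f g
    (k : {ffun 'I_n -> int}) :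
  good k -> (forall q, good q -> f q = g q) -> walk l f k = walk l g k.
Proof.
move=> gk fg; elim: l k gk => [|sx l IH] k gk; first exact: fg.
rewrite !walk_cons; apply: eq_bigr => e _.
by case: (boolP (good _)) => [gs|_]; rewrite ?mul0r // IH.
Qed.

Lemma walk0 (R : comNzRingType) n (l : seq (int * R)) (k : {ffun 'I_n -> int}) :
  walk l (fun=> 0) k = 0.
Proof.
elim: l k => [//|sx l IH] k; rewrite walk_cons /step big1 // => e _.
by rewrite IH !mulr0.
Qed.

Section Pieri.
Variables (R : comNzRingType) (t : R) (M : nat).
Implicit Types (m : {ffun 'I_M -> int}) (q : {ffun 'I_M.+1 -> int}).

(** Horizontal for the sequences of column lengths, hence a vertical strip of the shapes, with [t]
    marking its cells. The larger shape has one more column because the strip may open a new one. *)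
Definition hstrip m q : R :=
  \prod_(i < M.+1) ((strip_ok (ext q i) (ext m i) i (ext m i.-1))%:R
                    * t ^+ absz (ext q i - ext m i)%R).

Lemma hstrip_bad_top m q : good m -> ~~ good q -> hstrip m q = 0.
Proof.
move=> gm bq; apply/eqP; apply: contraNT bq => nz.
have ok i : (i < M.+1)%N -> strip_ok (ext q i) (ext m i) i (ext m i.-1).
  move=> lt; apply: contraNT nz => /negbTE no; apply/eqP.
  by rewrite /hstrip (bigD1 (Ordinal lt)) //= no !mul0r.
apply: good_ext => i; have [lt|ge] := ltnP i M; last first.
  rewrite [ext q i.+1]ext_ge //; have [e|ne] := eqVneq i M; last by rewrite ext_ge //; lia.
  by have := ok M (ltnSn _); rewrite /strip_ok [ext m M]ext_ge // e => /andP[].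
have := ok i; have := ok i.+1; rewrite /strip_ok /= => h1 h2.
have {h1}/andP[_ h1] := h1 lt; have {h2}/andP[h2 _] := h2 (ltnW lt).
exact: le_trans h1 h2.
Qed.

Lemma hstrip_bad_bottom m q : good q -> ~~ good m -> hstrip m q = 0.
Proof.
move=> gq bm; apply/eqP; apply: contraNT bm => nz.
have ok i : (i < M.+1)%N -> strip_ok (ext q i) (ext m i) i (ext m i.-1).
  move=> lt; apply: contraNT nz => /negbTE no; apply/eqP.
  by rewrite /hstrip (bigD1 (Ordinal lt)) //= no !mul0r.
apply: good_ext => i; have [lt|ge] := ltnP i M; last by rewrite !ext_ge // ltnW.
have := ok i.+1 lt; rewrite /strip_ok /= => /andP[h1 h2]; exact: le_trans h1 h2.
Qed.

Lemma ext_shift n s (e : {ffun 'I_n -> bool}) (q : {ffun 'I_n -> int}) (i : 'I_n) :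
  ext (shift s e q) i = ext q i + if e i then s else 0.
Proof. by rewrite !ext_ord ffunE. Qed.

(** A commutation of strips that factors over the columns. The factor [1 + t * x] is what
    [local_prod] leaves at column [M.+1], where the zero extensions of [k] and [m] are in
    contact. *)
Lemma step_hstrip (x : R) m (k : {ffun 'I_M.+1 -> int}) : good m -> good k ->
  step (1, x) (hstrip m) k
  = (1 + t * x) * \sum_(e : {ffun 'I_M -> bool})
      x ^+ (\sum_j e j)%N * hstrip (shift (-1) e m) k.
Proof.
move=> gm gk; rewrite /step /=.
transitivity (\prod_(i < M.+1) Lfac t x (ext k) (ext m) i).
  rewrite /Lfac (bigA_distr_bigA (fun (i : 'I_M.+1) (b : bool) =>
    x ^+ b * ((strip_ok (ext k i + b%:Z) (ext m i) i (ext m i.-1))%:R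
       * t ^+ absz (ext k i + b%:Z - ext m i)%R))).
  apply: eq_bigr => e _; rewrite big_split /= -prodrXr; congr (_ * _).
  have -> : (good (shift 1 e k))%:R * hstrip m (shift 1 e k) = hstrip m (shift 1 e k).
    case: (boolP (good _)) => [_|b]; first by rewrite mul1r.
    by rewrite hstrip_bad_top // mulr0.
  by apply: eq_bigr => i _; rewrite ext_shift; case: (e i).
have kd i : ext k i.+1 <= ext k i by have [] := ext_good i gk.
have md i : ext m i.+1 <= ext m i by have [] := ext_good i gm.
have := local_prod t x kd md M.+1.
rewrite /below /touch /= !ext_ge // lexx eqxx mulr1 expr1 => ->.
rewrite mulrC; congr (_ * _); rewrite big_ord_recr /=.
have -> : Mfac t x (ext k) (ext m) M = t ^+ absz (ext k M).
  have [k0 _] := ext_good M gk.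
  rewrite /Mfac big_bool [ext k M.+1]ext_ge // [ext m M]ext_ge // k0 /=.
  by rewrite mul0r mulr0 add0r expr0 !mul1r oppr0 subr0.
rewrite /Mfac (bigA_distr_bigA (fun (i : 'I_M) (b : bool) =>
    x ^+ b * (((ext k i.+1 <= ext m i - b%:Z) && (ext m i - b%:Z <= ext k i))%:R
      * t ^+ absz (ext k i - (ext m i - b%:Z))%R))).
rewrite big_distrl; apply: eq_bigr => e _ /=.
rewrite big_split /= prodrXr -mulrA; congr (_ * _).
set m' := shift (-1) e m.
have m'E (i : 'I_M) : ext m i - (e i)%:Z = ext m' i.
  by rewrite ext_shift; case: (e i); rewrite ?subr0 ?addr0.
under eq_bigr => i _ do rewrite m'E.
(* Interlacing is stored by the columns of the larger shape [k]; shifting the second family of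
   conditions by one index collects the two bounds on each column of [m']. *)
have -> : hstrip m' k =
    (\prod_(i < M.+1) (ext m' i <= ext k i)%R%:R)
    * (\prod_(i < M.+1) ((i == 0 :> nat)%N || (ext k i <= ext m' i.-1)%R)%:R)
    * \prod_(i < M.+1) t ^+ absz (ext k i - ext m' i)%R.
  rewrite -!big_split /=; apply: eq_bigr => i _; congr (_ * _).
  by rewrite /strip_ok -natrM mulnb.
rewrite [X in _ = X * _ * _]big_ord_recr [X in _ = _ * X * _]big_ord_recl
  [X in _ = _ * X]big_ord_recr /=.
rewrite ![ext m' M]ext_ge // subr0; have [-> _] := ext_good M gk.
rewrite mulr1 mul1r mulrA; congr (_ * _); rewrite -!big_split /=.
apply: eq_bigr => i _; congr (_ * _).
by rewrite -natrM mulnb /= andbC.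
Qed.

Lemma walk_hstrip xs m :
  walk (ups xs) (hstrip m) 0 = \prod_(x <- xs) (1 + t * x) * walk (ups xs) (delta R m) 0.
Proof.
have bad ys m' : ~~ good m' -> walk (ups ys) (hstrip m') 0 = 0.
  move=> bm; rewrite -[RHS](walk0 (ups ys) (0 : {ffun 'I_M.+1 -> int})).
  by apply: eq_walk_goodT => [|q gq]; [exact: good0 | exact: hstrip_bad_bottom].
have [gm|bm] := boolP (good m); last by rewrite bad // walk_bad ?good0 // mulr0.
elim/last_ind: xs m gm => [|xs x IH] m gm.
  rewrite /= big_nil mul1r /delta /hstrip.
  have [<-|ne] := eqVneq 0 m.
    by rewrite big1 // => i _; rewrite /strip_ok !ext0 lexx orbT subrr mulr1.
  have /existsP[j mj] : [exists j, m j != 0].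
    rewrite -negb_forall; apply: contra ne => /forallP h.
    by apply/eqP/ffunP => j; rewrite ffunE; apply/eqP; rewrite eq_sym.
  have lt : (j < M.+1)%N by apply: leqW.
  have /goodP[m0 _] := gm.
  rewrite (bigD1 (Ordinal lt)) //= /strip_ok ext0 ext_ord.
  by rewrite leNgt lt0r mj m0 !mul0r.
rewrite /ups map_rcons -/(ups xs) walk_rcons_delta // walk_rcons big_rcons /=.
rewrite (@eq_walk_goodT _ _ _ _ (fun q => \sum_(e : {ffun 'I_M -> bool})
    ((1 + t * x) * x ^+ (\sum_j e j)%N) * hstrip (shift (-1) e m) q)) ?good0 //; last first.
  move=> q gq; rewrite step_hstrip // big_distrr.
  by apply: eq_bigr => e _; rewrite /= mulrA.
rewrite (walk_sum predT (fun e : {ffun 'I_M -> bool} => (1 + t * x) * x ^+ (\sum_j e j)%N) _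
  (fun e : {ffun 'I_M -> bool} => hstrip (shift (-1) e m))) big_distrr /=.
apply: eq_bigr => e _; case: (boolP (good (shift (-1) e m))) => [/IH ->|bm].
  by rewrite -!mulrA [RHS]mulrCA; congr (_ * _); rewrite mulrCA.
by rewrite bad // walk_bad ?good0 // !mulr0.
Qed.

End Pieri.

(** * Odd rows as a vertical strip over a shape with even rows *)

Section OddRows.
Variables (R : comNzRingType) (t : R) (w : nat).

(* A shape with columns [q] has [q_i - q_(i+1)] rows of length [i + 1]. *)
Definition odd_excess n (q : {ffun 'I_n -> int}) : nat :=
  (\sum_(i < n | ~~ odd i) absz (ext q i - ext q i.+1)%R)%N.

Definition double_config b (a : {ffun 'I_w -> 'I_b}) : {ffun 'I_(w + w) -> int} :=
  [ffun j => (a (half_ord j))%:Z].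

Lemma ext_double_config b (a : {ffun 'I_w -> 'I_b}) i (lt : (i./2 < w)%N) :
  ext (double_config a) i = (a (Ordinal lt))%:Z.
Proof.
have lt' : (i < w + w)%N by lia.
by rewrite (ext_lt _ lt') ffunE; congr (Posz (a _)); apply: val_inj.
Qed.

Lemma sum_delta_double b (q : {ffun 'I_(w + w) -> int}) :
  good q -> (forall i, q i <= b%:Z) ->
  \sum_(a : {ffun 'I_w -> 'I_b.+1}) delta R (double_config a) q = (paired q)%:R.
Proof.
move=> /goodP[q0 qd] qb; have [pq|npq] := boolP (paired q); last first.
  rewrite big1 // => a _; rewrite /delta; case: eqP => // e.
  case/negP: npq; apply/pairedP => i j ij; rewrite e !ffunE.
  by congr (Posz (a _)); apply: val_inj.
pose a0 : {ffun 'I_w -> 'I_b.+1} := [ffun l => inord (absz (q (odd_ord l)))].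
have a0E l : (a0 l)%:Z = q (odd_ord l).
  by rewrite ffunE inordK; have := q0 (odd_ord l); have := qb (odd_ord l); lia.
rewrite (bigD1 a0) //= big1 => [|a ne]; last first.
  rewrite /delta; case: eqP => // e; case/eqP: ne; apply/ffunP => l; apply: val_inj.
  have : (a0 l)%:Z = (a l)%:Z.
    by rewrite a0E e [LHS]ffunE; congr (Posz (a _)); apply: val_inj => /=; lia.
  by case.
rewrite addr0 /delta (_ : _ == _) //; apply/eqP/ffunP => j; rewrite ffunE a0E.
by have /pairedP := pq; apply => /=; lia.
Qed.

(** Interlacing at column [l.*2.+1] bounds the equal columns [l.*2] and [l.*2.+1] of the doubled
    shape from opposite sides, so [a l] must be that column of [q]. The strip then lies in the
    even-indexed columns and has one cell per odd row. *)
Lemma sum_hstrip_double b (q : {ffun 'I_(w + w).+1 -> int}) :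
  good q -> (forall i, q i <= b%:Z) ->
  \sum_(a : {ffun 'I_w -> 'I_b.+1}) hstrip t (double_config a) q = t ^+ odd_excess q.
Proof.
move=> gq qb; have eg i := ext_good i gq.
have eb i : ext q i <= b%:Z.
  by have [lt|ge] := ltnP i (w + w).+1; [rewrite ext_lt | rewrite ext_ge].
pose a0 : {ffun 'I_w -> 'I_b.+1} := [ffun l : 'I_w => inord (absz (ext q l.*2.+1))].
have a0E (l : 'I_w) : (a0 l)%:Z = ext q l.*2.+1.
  by rewrite ffunE inordK; have [] := eg l.*2.+1; have := eb l.*2.+1; lia.
rewrite (bigD1 a0) //= big1 => [|a ne]; last first.
  have [l al] : exists l : 'I_w, (a l)%:Z != ext q l.*2.+1.
    apply/existsP; rewrite -negb_forall; apply: contra ne => /forallP h.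
    apply/eqP/ffunP => l; apply: val_inj; have /eqP := h l; rewrite -a0E.
    by case.
  have lw := ltn_ord l.
  have l2 : (l.*2.+1 < (w + w).+1)%N by lia.
  have mE i : i./2 = l :> nat -> ext (double_config a) i = (a l)%:Z.
    move=> il; have lt : (i./2 < w)%N by rewrite il.
    by rewrite (ext_double_config _ lt); congr (Posz (a _)); apply: val_inj.
  rewrite /hstrip (bigD1 (Ordinal l2)) //= /strip_ok !mE //=; [|lia..].
  by rewrite -eq_le (negbTE al) !mul0r.
have mE i : (i <= w + w)%N -> ext (double_config a0) i = ext q (i./2).*2.+1.
  move=> iw; have [lt|ge] := ltnP (i./2) w; first by rewrite (ext_double_config _ lt) a0E.
  by rewrite !ext_ge //; lia.
rewrite addr0 /hstrip /odd_excess -prodrXr [RHS]big_mkcond /=; apply: eq_bigr => i _.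
have iw : (i <= w + w)%N by have := ltn_ord i; lia.
rewrite !mE; [|lia..].
have [oi|ei] := boolP (odd i) => /=.
  have -> : (i./2).*2.+1 = i by lia.
  have -> : ((i.-1)./2).*2.+1 = i by lia.
  by rewrite /strip_ok lexx orbT subrr mulr1.
have -> : (i./2).*2 = i by lia.
rewrite (_ : strip_ok _ _ _ _) ?mul1r //; rewrite /strip_ok; have [_ ->] := eg i.
have [//|i0] := posnP i; have -> : ((i.-1)./2).*2.+1 = i.-1 by lia.
by have [_] := eg i.-1; rewrite prednK.
Qed.

Lemma walk_odd_excess (xs : seq R) :
  walk (ups xs) (fun q : {ffun 'I_(w + w).+1 -> int} => t ^+ odd_excess q) 0
  = \prod_(x <- xs) (1 + t * x) * walk (ups xs) (fun q => (@paired w q)%:R) 0.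
Proof.
pose b := size xs.
have all_ups : all (fun sx : int * R => sx.1 <= 1) (ups xs) by rewrite all_map; apply/allP.
have sz : size (ups xs) = b by rewrite size_map.
transitivity (\sum_(a : {ffun 'I_w -> 'I_b.+1})
    1 * walk (ups xs) (hstrip t (double_config a)) 0).
  rewrite -walk_sum; apply: (@eq_walk_good _ _ _ _ _ 0) => //; first exact: good0.
    by move=> i; rewrite ffunE.
  move=> q gq; rewrite add0n sz => qb; rewrite -(sum_hstrip_double gq qb).
  by apply: eq_bigr => a _; rewrite mul1r.
transitivity (\prod_(x <- xs) (1 + t * x) * \sum_(a : {ffun 'I_w -> 'I_b.+1})
    1 * walk (ups xs) (delta R (double_config a)) 0).
  by rewrite big_distrr; apply: eq_bigr => a _ /=; rewrite !mul1r walk_hstrip.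
rewrite -walk_sum; congr (_ * _); apply: (@eq_walk_good _ _ _ _ _ 0) => //; first exact: good0.
  by move=> i; rewrite ffunE.
move=> q gq; rewrite add0n sz => qb; rewrite -(sum_delta_double gq qb).
by apply: eq_bigr => a _; rewrite mul1r.
Qed.

End OddRows.

(** * Extraction of a coefficient in the marker *)

Section Coefficients.
Variables (R : comNzRingType) (N : nat).

Definition liftC (l : seq (int * R)) : seq (int * {poly R}) :=
  [seq (sx.1, sx.2%:P) | sx <- l].

Lemma coef_walk l (F : {ffun 'I_N -> int} -> {poly R}) (k : {ffun 'I_N -> int}) j :
  (walk (liftC l) F k)`_j = walk l (fun q => (F q)`_j) k.
Proof.
elim: l k => [//|sx l IH] k; rewrite /= coef_sum; apply: eq_bigr => e _ /=.
rewrite -polyC_exp coefCM -IH; congr (_ * _).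
by case: (good _); rewrite ?mul1r ?mul0r ?coef0.
Qed.

Lemma walk_polyC l (f : {ffun 'I_N -> int} -> R) (k : {ffun 'I_N -> int}) :
  walk (liftC l) (fun q => (f q)%:P) k = (walk l f k)%:P.
Proof.
apply/polyP => j; rewrite coef_walk coefC.
case: ifP => [/eqP ->|j0].
  by apply: eq_walk => q; rewrite coefC eqxx.
by rewrite -[RHS](walk0 l k); apply: eq_walk => q; rewrite coefC j0.
Qed.

End Coefficients.

(** With the polynomial variable as marker [t], the coefficient of degree [k] selects the shapes
    with [k] odd rows. *)
Lemma walk_odd_excess_eq (R : idomainType) (char0 : forall m, m.+1%:R != 0 :> R)
    (w k : nat) (xs : seq R) :
  walk (ups xs) (fun q : {ffun 'I_(w + w).+1 -> int} => (odd_excess q == k)%:R) 0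
  = (\prod_(x <- xs) (1 + 'X * x%:P))`_k
    * walk (updowns xs) (delta R (0 : {ffun 'I_w -> int})) 0.
Proof.
have upsE : ups [seq x%:P | x <- xs] = liftC (ups xs) by rewrite /ups /liftC -!map_comp.
have := walk_odd_excess 'X w [seq x%:P | x <- xs]; rewrite upsE big_map.
have -> : walk (liftC (ups xs)) (fun q => (@paired w q)%:R) 0
    = (walk (ups xs) (fun q => (@paired w q)%:R) 0)%:P.
  by rewrite -walk_polyC; apply: eq_walk => q; rewrite rmorph_nat.
rewrite walk_paired // => /(congr1 (fun p : {poly R} => p`_k)).
rewrite coefMC coef_walk => <-.
by apply: eq_walk => q; rewrite coefXn eq_sym.
Qed.

(** * Walks unrolled as sums over sequences of moves *)

Section PathSum.
Variables (R : comNzRingType) (N : nat).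
Implicit Types (l : seq (int * R)).
Local Notation eps := {ffun 'I_N -> bool}.

Definition e0 : eps := [ffun=> false].

Definition conf l (E : seq eps) (i : nat) (k : {ffun 'I_N -> int}) : {ffun 'I_N -> int} :=
  [ffun j => k j + \sum_(a < i) (if nth e0 E a j then (nth (0, 0) l a).1 else 0)].

Lemma conf0 l E k : conf l E 0 k = k.
Proof. by apply/ffunP => j; rewrite ffunE big_ord0 addr0. Qed.

Lemma conf_cons sx l e E i k :
  conf (sx :: l) (e :: E) i.+1 k = conf l E i (shift sx.1 e k).
Proof. by apply/ffunP => j; rewrite !ffunE big_ord_recl addrA. Qed.

Lemma big_cons_tuple (A : finType) n (P : pred (n.+1.-tuple A)) (F : n.+1.-tuple A -> R) :
  \sum_(t | P t) F t = \sum_(a : A) \sum_(t : n.-tuple A | P (cons_tuple a t)) F (cons_tuple a t).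
Proof.
rewrite pair_big_dep /= (reindex (fun p : A * n.-tuple A => cons_tuple p.1 p.2)) //=.
exists (fun t : n.+1.-tuple A => (thead t, behead_tuple t)) => [[a t]|t] _ /=.
  by congr (_, _); apply: val_inj.
by rewrite [RHS]tuple_eta; apply: val_inj.
Qed.

Lemma walkE n l f k : size l = n ->
  walk l f k
  = \sum_(E : n.-tuple eps | [forall i : 'I_n, good (conf l E i.+1 k)])
      \prod_(i < n) (nth (0, 0) l i).2 ^+ (\sum_j nth e0 E i j)%N * f (conf l E n k).
Proof.
elim: n l k => [|n IH] l k /=.
  move/size0nil => ->; rewrite (big_pred1 [tuple]) => [|E].
    by rewrite big_ord0 mul1r conf0.
  by transitivity true; [apply/forallP => -[] | apply/esym/eqP; rewrite [LHS]tuple0].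
case: l => [//|sx l] [sl]; rewrite walk_cons big_cons_tuple; apply: eq_bigr => e _.
rewrite IH // !big_distrr /= big_mkcond [RHS]big_mkcond; apply: eq_bigr => E _ /=.
have -> : [forall i : 'I_n.+1, good (conf (sx :: l) (e :: E) i.+1 k)]
    = good (shift sx.1 e k) && [forall i : 'I_n, good (conf l E i.+1 (shift sx.1 e k))].
  apply/forallP/andP => [h|[h0 /forallP h] i].
    split; first by have := h ord0; rewrite conf_cons conf0.
    by apply/forallP => i; have := h (lift ord0 i); rewrite conf_cons lift0.
  by rewrite conf_cons; case: (unliftP ord0 i) => [j ->|->]; rewrite ?lift0 ?conf0.
case: ifP => _; last by rewrite andbF.
case: (good _) => /=; last by rewrite mul0r mulr0.
by rewrite big_ord_recl /= conf_cons mul1r mulrA.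
Qed.

End PathSum.

(** * Semistandard tableaux as walks of column heights *)

Definition height (la : seq nat) (j : nat) : nat := count (ltn j) la.

Lemma geq_trans : transitive geq.
Proof. by move=> x y z yx xz; exact: leq_trans xz yx. Qed.

Lemma lt_height (la : seq nat) (r j : nat) :
  sorted geq la -> (j < nth 0%N la r)%N = (r < height la j)%N.
Proof.
rewrite /height; elim: la r => [|a la IH] r /=; first by rewrite nth_nil.
move=> pa; have sla := path_sorted pa.
have [ja|aj] := ltnP j a; first by case: r => [|r] /=; rewrite ?ja // IH.
have /allP al := order_path_min geq_trans pa.
rewrite add0n (_ : count _ _ = 0)%N; last first.
  apply/eqP; rewrite -leqn0 leqNgt -has_count; apply/hasPn => b /al /= ba.
  by rewrite -leqNgt (leq_trans ba).
apply/negbTE; rewrite -leqNgt; case: r => [//|r] /=.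
have [rs|?] := ltnP r (size la); last by rewrite nth_default.
by rewrite (leq_trans _ aj) //; apply: al; apply: mem_nth.
Qed.

Section Tableaux.
Variables (n' N : nat) (la : seq nat).
Local Notation n := n'.+1.
Hypotheses (pla : sorted geq la) (hla : (head 0%N la <= N)%N).
Local Notation eps := {ffun 'I_N -> bool}.
Implicit Types (E : seq eps) (t : {ffun cell la -> 'I_n}) (c d : cell la).

Lemma nth_le_head r : (nth 0%N la r <= head 0%N la)%N.
Proof.
rewrite leqNgt lt_height //; apply/negP => /(leq_ltn_trans (leq0n r)).
by rewrite -lt_height // nth0 ltnn.
Qed.

Lemma cell_lt c : (cell_col c < nth 0%N la (cell_row c))%N.
Proof. exact: ltn_ord. Qed.

Lemma cell_height c : (cell_row c < height la (cell_col c))%N.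
Proof. by rewrite -lt_height // cell_lt. Qed.

Lemma cell_col_lt c : (cell_col c < N)%N.
Proof.
by apply: leq_trans hla; apply: leq_trans (cell_lt c) (nth_le_head _).
Qed.

Lemma cell_inj c d : cell_row c = cell_row d -> cell_col c = cell_col d -> c = d.
Proof.
case: c d => [i j] [i' j']; rewrite /cell_row /cell_col /= => /val_inj e.
by subst i'; move=> /val_inj ->.
Qed.

Lemma cell_mk (r j : nat) : (r < height la j)%N ->
  exists2 c : cell la, cell_row c = r & cell_col c = j.
Proof.
rewrite -lt_height // => jr.
have rs : (r < size la)%N by rewrite ltnNge; apply: contraL jr => /(nth_default 0%N) ->.
by exists (Tagged (fun i : 'I_(size la) => 'I_(nth 0%N la i))
  (Ordinal jr : 'I_(nth 0%N la (Ordinal rs)))).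
Qed.

Definition cell_ord c : 'I_N := Ordinal (cell_col_lt c).

(** For the code of a tableau: the number of entries of column [j] that are smaller than [i]. *)
Definition psum E (i : nat) (j : 'I_N) : nat := (\sum_(a < i) nth (e0 N) E a j)%N.

Lemma psumS E i j : psum E i.+1 j = (psum E i j + nth (e0 N) E i j)%N.
Proof. by rewrite /psum big_ord_recr. Qed.

Lemma leq_psum E i i' j : (i <= i')%N -> (psum E i j <= psum E i' j)%N.
Proof.
elim: i' => [|i' IH]; first by rewrite leqn0 => /eqP ->.
by rewrite leq_eqVlt => /predU1P[-> //|/IH h]; rewrite psumS (leq_trans h) ?leq_addr.
Qed.

(** The chain of shapes formed by the entries smaller than [i]. The relation determines [t] from [E]
    and, among admissible codes, [E] from [t], so that both composites of coding and decoding are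
    settled by it. *)
Definition encodes t E : Prop :=
  forall c (i : nat), (i <= n)%N -> (t c < i)%N = (cell_row c < psum E i (cell_ord c))%N.

Definition admissible E : Prop :=
  [/\ forall (i : nat) (j j' : 'I_N), (i <= n)%N -> (j <= j')%N ->
        (psum E i j' <= psum E i j)%N
    & forall j : 'I_N, psum E n j = height la j].

Definition tab_code t : n.-tuple eps :=
  [tuple [ffun j : 'I_N => [exists c, (cell_col c == j) && (t c == i)]] | i < n].

Lemma nth_tab_code t (i : 'I_n) j :
  nth (e0 N) (tab_code t) i j = [exists c, (cell_col c == j) && (t c == i)].
Proof. by rewrite -tnth_nth tnth_mktuple ffunE. Qed.

Lemma semistandardP t : reflect
  ((forall c d, cell_row c = cell_row d -> (cell_col c < cell_col d)%N -> (t c <= t d)%N) /\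
   (forall c d, cell_col c = cell_col d -> (cell_row c < cell_row d)%N -> (t c < t d)%N))
  (semistandard t).
Proof.
apply: (iffP forallP) => [h|[h1 h2] c].
  split=> c d e lt; have /forallP/(_ d)/andP[h1 h2] := h c.
    by move: h1; rewrite e eqxx lt.
  by move: h2; rewrite e eqxx lt.
apply/forallP => d; apply/andP; split; apply/implyP => /andP[/eqP e lt].
  exact: h1.
exact: h2.
Qed.

Lemma tab_code_encodes t : semistandard t ->
  encodes t (tab_code t) /\
  forall (i : nat) (j : 'I_N), (i <= n)%N -> (psum (tab_code t) i j <= height la j)%N.
Proof.
move=> /semistandardP[_ strict].
pose P i := forall c, (t c < i)%N = (cell_row c < psum (tab_code t) i (cell_ord c))%N.
(* By column strictness the cell just above has a smaller entry, so a letter [i] sits immediately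
   under the smaller letters of its column. *)
have rowE (i : 'I_n) c : P i -> t c = i -> cell_row c = psum (tab_code t) i (cell_ord c).
  move=> Pi tc; apply/eqP; rewrite eqn_leq; apply/andP; split; last first.
    by rewrite leqNgt -Pi tc ltnn.
  have [r0|r0] := posnP (cell_row c); first by rewrite r0.
  have [d dr dc] : exists2 d : cell la, cell_row d = (cell_row c).-1 & cell_col d = cell_col c.
    by apply: cell_mk; apply: leq_ltn_trans (leq_pred _) (cell_height c).
  have : (t d < i)%N by rewrite -tc; apply: strict => //; rewrite dr; lia.
  rewrite Pi (_ : cell_ord d = cell_ord c); last by apply: val_inj.
  by rewrite dr; lia.
have H i : (i <= n)%N -> P i /\
    forall j : 'I_N, (psum (tab_code t) i j <= height la j)%N.
  elim: i => [|i IH] ile.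
    by split=> [c|j]; rewrite /psum big_ord0.
  have [Pi hi] := IH (ltnW ile); pose i0 := Ordinal ile.
  have bitP (j : 'I_N) : reflect (exists2 c, cell_ord c = j & t c = i0)
      (nth (e0 N) (tab_code t) i j).
    rewrite (nth_tab_code t i0); apply: (iffP existsP) => [[c /andP[/eqP cj /eqP tc]]|[c cj tc]].
      by exists c => //; apply: val_inj.
    by exists c; rewrite tc eqxx andbT -cj.
  split=> [c|j]; rewrite psumS; last first.
    case: bitP => [[d dj td]|_]; last by rewrite addn0.
    by have := rowE i0 d Pi td; rewrite dj => <-; rewrite addn1 -dj; apply: cell_height.
  rewrite ltnS leq_eqVlt Pi.
  case: (ltngtP (t c) i) => [lt|gt|e].
  - by rewrite -Pi lt ltn_addr // -Pi.
  - have ge : (psum (tab_code t) i (cell_ord c) <= cell_row c)%N.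
      by rewrite leqNgt -Pi -leqNgt ltnW.
    rewrite ltnNge ge /=; apply/esym/negbTE; rewrite -leqNgt.
    case: bitP => [[d dc td]|_]; last by rewrite addn0.
    rewrite addn1 -dc -(rowE i0 d Pi td) ltnNge; apply/negP => le.
    have cdc : cell_col c = cell_col d by have /(congr1 val) := dc.
    have : (t c <= t d)%N.
      move: le; rewrite leq_eqVlt => /predU1P[er|lt]; last by apply/ltnW/strict.
      by rewrite (@cell_inj c d).
    by rewrite td /= leqNgt gt.
  - have tc : t c = i0 by apply: val_inj.
    rewrite /=; case: bitP => [_|[]]; last by exists c.
    by rewrite addn1 -(rowE i0 c Pi tc) ltnSn.
by split=> [c i|i j] /H[].
Qed.

Lemma tab_code_admissible t : semistandard t -> admissible (tab_code t).
Proof.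
move=> st; have [enc le] := tab_code_encodes st; have /semistandardP[weak _] := st.
split=> [i j j' ile jj'|j].
  rewrite leqNgt; apply/negP => lt.
  (* In row [r] column [j] has no entry smaller than [i] while column [j'], further right, has one:
     rows would not increase weakly. *)
  set r := psum _ i j in lt.
  have rh : (r < height la j')%N by apply: leq_trans lt (le _ _ ile).
  have rh' : (r < height la j)%N.
    by rewrite -lt_height // (leq_ltn_trans jj') // lt_height.
  have [c' c'r c'j] := cell_mk rh; have [c cr cj] := cell_mk rh'.
  have oc' : cell_ord c' = j' by apply: val_inj.
  have oc : cell_ord c = j by apply: val_inj.
  have tc' : (t c' < i)%N by rewrite enc // oc' c'r.
  have : (t c <= t c')%N.
    move: jj'; rewrite leq_eqVlt => /predU1P[e|lt'].
      by rewrite (@cell_inj c c') ?cr ?c'r // cj c'j.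
    by apply: weak; rewrite ?cr ?c'r // cj c'j.
  by move=> /leq_ltn_trans/(_ tc'); rewrite enc // oc cr ltnn.
apply/eqP; rewrite eqn_leq le //= leqNgt; apply/negP => lt.
have [c cr cj] := cell_mk lt.
have oc : cell_ord c = j by apply: val_inj.
by have := ltn_ord (t c); rewrite enc // oc cr ltnn.
Qed.

(** The default [ord0], for which the alphabet is nonempty, is never reached when [E] is admissible,
    as [code_tabP] shows. *)
Definition code_tab E : {ffun cell la -> 'I_n} :=
  [ffun c => odflt ord0 [pick i : 'I_n |
     (psum E i (cell_ord c) <= cell_row c < psum E i.+1 (cell_ord c))%N]].

Lemma code_tabP E c : admissible E ->
  (psum E (code_tab E c) (cell_ord c) <= cell_row c
     < psum E (code_tab E c).+1 (cell_ord c))%N.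
Proof.
case=> _ hE; rewrite ffunE; case: pickP => [//|none].
have ex : exists i, (cell_row c < psum E i (cell_ord c))%N.
  by exists n; rewrite hE cell_height.
case: (ex_minnP ex) => [[|i]]; first by rewrite /psum big_ord0.
move=> hi min.
have ile : (i < n)%N by apply: (min n); rewrite hE cell_height.
have := none (Ordinal ile); rewrite /= hi andbT leqNgt => /negbFE /min.
by rewrite ltnn.
Qed.

Lemma code_tab_encodes E : admissible E -> encodes (code_tab E) E.
Proof.
move=> aE c i _; have /andP[lo hi] := code_tabP c aE.
have [lt|ge] := ltnP (code_tab E c) i.
  by rewrite (leq_trans hi) ?leq_psum.
by apply/esym/negbTE; rewrite -leqNgt (leq_trans _ lo) ?leq_psum.
Qed.

Lemma code_tab_semistandard E : admissible E -> semistandard (code_tab E).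
Proof.
move=> aE; have enc := code_tab_encodes aE; have [dec _] := aE.
apply/semistandardP; split=> c d e lt.
  have tdn : (code_tab E d < n)%N := ltn_ord _.
  rewrite -ltnS enc // e; have /andP[_ hi] := code_tabP d aE.
  by rewrite (leq_trans hi) // dec //= ltnW.
rewrite enc ?(ltnW (ltn_ord _)) //.
have oc : cell_ord c = cell_ord d by apply: val_inj.
have /andP[_ hi] := code_tabP d aE; move: hi; rewrite psumS oc.
by have := leq_b1 (nth (e0 N) E (code_tab E d) (cell_ord d)); lia.
Qed.

Lemma encodes_inj_tab t t' E : encodes t E -> encodes t' E -> t = t'.
Proof.
move=> h h'; apply/ffunP => c; apply: val_inj; apply/eqP => /=.
rewrite eqn_leq -ltnS h ?ltn_ord // -h' ?ltn_ord // ltnS leqnn /=.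
by rewrite -ltnS h' ?ltn_ord // -h ?ltn_ord // ltnS leqnn.
Qed.

Lemma encodes_inj_code t (E E' : n.-tuple eps) :
  admissible E -> admissible E' -> encodes t E -> encodes t E' -> E = E'.
Proof.
move=> aE aE' h h'.
have half (F F' : n.-tuple eps) i j : admissible F -> encodes t F -> encodes t F' ->
    admissible F' -> (i <= n)%N -> (psum F i j <= psum F' i j)%N.
  move=> aF hF hF' aF' ile; rewrite leqNgt; apply/negP => lt.
  have lt' : (psum F' i j < height la j)%N.
    by case: aF => _ <-; apply: leq_trans lt (leq_psum _ _ ile).
  have [c cr cj] := cell_mk lt'.
  have oc : cell_ord c = j by apply: val_inj.
  by have := hF c i ile; rewrite hF' // oc cr ltnn lt.
have eqS i j : (i <= n)%N -> psum E i j = psum E' i j.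
  by move=> ile; apply/eqP; rewrite eqn_leq !half.
apply: eq_from_tnth => i; apply/ffunP => j; rewrite !(tnth_nth (e0 N)).
have := eqS i.+1 j (ltn_ord i); rewrite !psumS eqS ?(ltnW (ltn_ord i)) // => /addnI.
by case: (nth (e0 N) E i j); case: (nth (e0 N) E' i j).
Qed.

(** A letter occurs at most once in a column, so its multiplicity is the number of columns that
    contain it. *)
Lemma tab_weight (R : comNzRingType) (x : 'I_n -> R) t : semistandard t ->
  \prod_c x (t c) = \prod_(i < n) x i ^+ (\sum_j nth (e0 N) (tab_code t) i j)%N.
Proof.
move=> /semistandardP[_ strict].
rewrite (partition_big t predT) //=; apply: eq_bigr => i _.
rewrite (eq_bigr (fun=> x i)) => [|c /eqP -> //]; rewrite prodr_const; congr (_ ^+ _).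
rewrite (eq_bigr (fun j => nat_of_bool (j \in [set cell_ord c | c in [pred c | t c == i]]%SET))).
  rewrite -big_mkcond /= sum1_card card_in_imset // => c d /eqP tc /eqP td /(congr1 val) /= e.
  case: (ltngtP (cell_row c) (cell_row d)) => [lt|lt|e']; last exact: cell_inj.
    by have := strict _ _ e lt; rewrite tc td ltnn.
  by have := strict _ _ (esym e) lt; rewrite tc td ltnn.
move=> j _; rewrite nth_tab_code; congr nat_of_bool.
apply/existsP/imsetP => [[c /andP[/eqP cj tc]]|[c tc ->]].
  by exists c => //; apply: val_inj.
by exists c; rewrite eqxx.
Qed.

End Tableaux.

Definition height_conf (N : nat) (la : seq nat) : {ffun 'I_N -> int} :=
  [ffun j : 'I_N => (height la j)%:Z].

Lemma conf_ups (R : comNzRingType) N (xs : seq R) (E : seq {ffun 'I_N -> bool}) i j :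
  (i <= size xs)%N -> conf (ups xs) E i 0 j = (psum E i j)%:Z.
Proof.
move=> ile; rewrite !ffunE add0r /psum -[RHS]natz natr_sum.
apply: eq_bigr => a _.
rewrite (nth_map 0); last by apply: leq_trans ile.
by case: (nth (e0 N) E a j).
Qed.

Definition mvars (n : nat) : seq {mpoly int[n]} := [seq 'X_i | i <- enum 'I_n].

Lemma size_mvars n : size (mvars n) = n.
Proof. by rewrite size_map size_enum_ord. Qed.

Lemma nth_mvars n (i : 'I_n) : nth 0 (mvars n) i = 'X_i.
Proof. by rewrite (nth_map i) ?size_enum_ord // nth_ord_enum. Qed.

Lemma schur_walk (n N : nat) (la : seq nat) :
  (0 < n)%N -> sorted geq la -> (head 0%N la <= N)%N ->
  schur n la = walk (ups (mvars n)) (delta _ (height_conf N la)) 0.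
Proof.
case: n => [//|n] _ pla hla.
rewrite (@walkE _ _ n.+1); last by rewrite size_map size_mvars.
pose P (E : n.+1.-tuple {ffun 'I_N -> bool}) :=
  [forall i : 'I_n.+1, good (conf (ups (mvars n.+1)) E i.+1 0)]
  && (conf (ups (mvars n.+1)) E n.+1 0 == height_conf N la).
have PP (E : n.+1.-tuple {ffun 'I_N -> bool}) : reflect (admissible n la E) (P E).
  apply: (iffP andP) => [[/forallP gE /eqP eE]|[dec eE]].
    split=> [[|i] j j' ile jj'|j]; first by rewrite /psum !big_ord0.
      have /goodP[_ /(_ _ _ jj')] := gE (Ordinal ile).
      by rewrite !conf_ups ?size_mvars.
    have := congr1 (fun q : {ffun 'I_N -> int} => q j) eE.
    by rewrite /= conf_ups ?size_mvars // ffunE => -[].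
  split.
    apply/forallP => i; apply/goodP; split=> [j|j j' jj'].
      by rewrite conf_ups ?size_mvars.
    by rewrite !conf_ups ?size_mvars //; apply: dec.
  by apply/eqP/ffunP => j; rewrite conf_ups ?size_mvars // eE ffunE.
transitivity (\sum_(E | P E) \prod_(i < n.+1)
    ('X_i : {mpoly int[n.+1]}) ^+ (\sum_j nth (e0 N) E i j)%N).
  rewrite (reindex_onto (@tab_code n N la) (@code_tab n N la pla hla)) /=; last first.
    move=> E /PP aE; have st := code_tab_semistandard pla hla aE.
    apply: (encodes_inj_code (pla := pla) (hla := hla) (t := @code_tab n N la pla hla E)) => //.
    - exact: tab_code_admissible.
    - by have [] := tab_code_encodes pla hla st.
    - exact: code_tab_encodes.
  rewrite /schur; apply: eq_big => [t|t st]; last exact: (tab_weight pla hla).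
  apply/idP/andP => [st|[/PP aE /eqP <-]]; last exact: code_tab_semistandard.
  have aE := tab_code_admissible pla hla st; split; first exact/PP.
  apply/eqP; apply: (encodes_inj_tab (code_tab_encodes pla hla aE)).
  by have [] := tab_code_encodes pla hla st.
rewrite big_mkcond [RHS]big_mkcond /=; apply: eq_bigr => E _.
rewrite /P; case: (boolP [forall i, _]) => //= _; rewrite /delta.
case: eqP => _; rewrite ?mulr0 // mulr1; apply: eq_bigr => i _.
by rewrite (nth_map 0) ?size_mvars //= nth_mvars.
Qed.

(** * The sum of Schur polynomials over shapes as one walk *)

Local Open Scope classical_set_scope.

Lemma fsbig_pred (R : nmodType) (A : finType) (P : pred A) (F : A -> R) :
  \sum_(x \in [set x | P x]) F x = \sum_(x | P x) F x.
Proof.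
have -> : [set x | P x] = [set` enum P] by apply/seteqP; split=> x /=; rewrite mem_enum.
by rewrite -fsbig_seq ?enum_uniq // big_enum.
Qed.

Lemma partition_ext (la mu : seq nat) : is_partition la -> is_partition mu ->
  (forall r, nth 0%N la r = nth 0%N mu r) -> la = mu.
Proof.
have half (s s' : seq nat) : is_partition s' ->
    (forall r, nth 0%N s r = nth 0%N s' r) -> (size s' <= size s)%N.
  move=> /andP[_ s'0] e; rewrite leqNgt; apply: contra s'0 => lt.
  by have := e (size s); rewrite nth_default // => ->; apply: mem_nth.
move=> pla pmu e; apply: (@eq_from_nth _ 0%N) => // ; apply/eqP; rewrite eqn_leq.
by rewrite !half.
Qed.

Lemma height_eq0 (la : seq nat) j : sorted geq la -> (head 0%N la <= j)%N -> height la j = 0%N.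
Proof.
by move=> pla; rewrite leqNgt -nth0 lt_height // lt0n negbK => /eqP.
Qed.

Lemma partition_ext_height (N : nat) (la mu : seq nat) :
  is_partition la -> is_partition mu -> (head 0%N la <= N)%N -> (head 0%N mu <= N)%N ->
  (forall j, (j < N)%N -> height la j = height mu j) -> la = mu.
Proof.
move=> pla pmu hla hmu e; apply: partition_ext => // r.
have sla : sorted geq la by case/andP: pla.
have smu : sorted geq mu by case/andP: pmu.
have e' j : height la j = height mu j.
  have [/e //|ge] := ltnP j N.
  by rewrite !height_eq0 // (leq_trans _ ge).
apply/eqP; rewrite eqn_leq; apply/andP; split; rewrite leqNgt lt_height //.
  by rewrite e' -lt_height // ltnn.
by rewrite -e' -lt_height // ltnn.
Qed.

Lemma count_odd_sum (N : nat) (la : seq nat) : all (fun x => 0 < x <= N)%N la ->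
  count odd la = (\sum_(i < N | ~~ odd i) count (pred1 i.+1) la)%N.
Proof.
elim: la => [|x la IH] /=; first by rewrite big1.
move=> /andP[/andP[x0 xN] /IH ->]; rewrite big_split /=; congr (_ + _)%N.
have lt : (x.-1 < N)%N by rewrite prednK.
rewrite big_mkcond (bigD1 (Ordinal lt)) //= big1 => [|i]; last first.
  rewrite -val_eqE /= => ne; case: ifP => // _.
  by rewrite (_ : (x == i.+1) = false) //; apply/negbTE; lia.
by rewrite prednK // eqxx addn0 -[in LHS](prednK x0) /=; case: (odd _).
Qed.

Lemma odd_rows_excess (N : nat) (la : seq nat) :
  is_partition la -> (head 0%N la <= N)%N -> odd_rows la = odd_excess (height_conf N la).
Proof.
move=> /andP[sla la0] hla.
have extE i : ext (height_conf N la) i = (height la i)%:Z.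
  have [lt|ge] := ltnP i N; first by rewrite ext_lt ffunE.
  by rewrite ext_ge // height_eq0 // (leq_trans hla).
rewrite /odd_rows (@count_odd_sum N); last first.
  apply/allP => x xla; rewrite lt0n; apply/andP; split.
    by apply: contraNneq la0 => <-.
  by rewrite -(nth_index 0%N xla) (leq_trans (nth_le_head sla _)).
apply: eq_bigr => i _; rewrite !extE.
have -> : height la i = (height la i.+1 + count (pred1 i.+1) la)%N.
  rewrite /height -count_predUI [X in (_ + X)%N](_ : _ = 0)%N ?addn0; last first.
    rewrite -(@count_pred0 _ la); apply: eq_count => x /=.
    by rewrite andbC; case: eqP => //= ->; rewrite ltnn.
  by apply: eq_count => x /=; rewrite orbC eq_sym -leq_eqVlt.
by lia.
Qed.

Section SumOverShapes.
Variables (n N : nat).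
Implicit Types a : {ffun 'I_N -> 'I_n.+1}.

Definition col_conf a : {ffun 'I_N -> int} := [ffun j => (a j)%:Z].
Definition col_seq a : seq nat := [seq val (a j) | j <- enum 'I_N].
(** Conjugate of the sequence of columns; stopping at the first column height leaves no zero part
    when the columns decrease. *)
Definition conj_shape a : seq nat := mkseq (height (col_seq a)) (head 0%N (col_seq a)).

Lemma nth_col_seq a (j : 'I_N) : nth 0%N (col_seq a) j = a j.
Proof. by rewrite (nth_map j) ?size_enum_ord // nth_ord_enum. Qed.

Lemma size_col_seq a : size (col_seq a) = N.
Proof. by rewrite size_map size_enum_ord. Qed.

Lemma sorted_col_seq a : good (col_conf a) -> sorted geq (col_seq a).
Proof.
move=> /goodP[_ dec]; apply/(sortedP 0%N) => i; rewrite size_col_seq => lt.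
rewrite (nth_col_seq a (Ordinal lt)) (nth_col_seq a (Ordinal (ltnW lt))) /=.
by have := dec (Ordinal (ltnW lt)) (Ordinal lt) (leqnSn i); rewrite !ffunE.
Qed.

Lemma nth_conj_shape a r : good (col_conf a) ->
  nth 0%N (conj_shape a) r = height (col_seq a) r.
Proof.
move=> ga; have [lt|ge] := ltnP r (head 0%N (col_seq a)); first by rewrite nth_mkseq.
by rewrite nth_default ?size_mkseq // height_eq0 // sorted_col_seq.
Qed.

Lemma sorted_conj_shape a : sorted geq (conj_shape a).
Proof.
apply/(sortedP 0%N) => i; rewrite size_mkseq => lt; rewrite !nth_mkseq ?(ltnW lt) //.
by apply: sub_count => x /= /ltnW.
Qed.

Lemma conj_shape_partition a : good (col_conf a) -> is_partition (conj_shape a).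
Proof.
move=> ga; rewrite /is_partition sorted_conj_shape /=.
apply/negP => /mapP[r]; rewrite mem_iota add0n => /andP[_ lt] e.
by move: lt; rewrite -nth0 lt_height ?sorted_col_seq // -e.
Qed.

Lemma head_conj_shape a : good (col_conf a) -> (head 0%N (conj_shape a) <= N)%N.
Proof.
move=> ga; rewrite -nth0 nth_conj_shape // -[X in (_ <= X)%N](size_col_seq a).
exact: count_size.
Qed.

Lemma size_conj_shape a : (size (conj_shape a) <= n)%N.
Proof.
rewrite size_mkseq -nth0; have [N0|N0] := posnP N.
  by rewrite nth_default // size_col_seq N0.
by rewrite (nth_col_seq a (Ordinal N0)) -ltnS.
Qed.

Lemma height_conj_shape a (j : 'I_N) : good (col_conf a) ->
  height (conj_shape a) j = a j.
Proof.
move=> ga; have E r : (r < height (conj_shape a) j)%N = (r < a j)%N.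
  rewrite -lt_height ?sorted_conj_shape // nth_conj_shape // -lt_height ?sorted_col_seq //.
  by rewrite nth_col_seq.
apply/eqP; rewrite eqn_leq; apply/andP; split; rewrite leqNgt.
  by rewrite E ltnn.
by rewrite -E ltnn.
Qed.

Lemma height_conf_conj a : good (col_conf a) -> height_conf N (conj_shape a) = col_conf a.
Proof. by move=> ga; apply/ffunP => j; rewrite !ffunE height_conj_shape. Qed.

Lemma sum_schur_walk (k : nat) : (0 < n)%N ->
  \sum_(la \in [set la | [/\ is_partition la, (head 0 la <= N)%N & odd_rows la = k]])
     schur n la
  = walk (ups (mvars n)) (fun q : {ffun 'I_N -> int} => (odd_excess q == k)%:R) 0.
Proof.
move=> n0.
(* Shapes with more than [n] rows have zero Schur polynomial; the others have columns of height at
   most [n], indexed by a finite type. *)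
rewrite -(@fsbig_widen _ _ _ _ [set la | [/\ is_partition la, (head 0 la <= N)%N &
    odd_rows la = k] /\ (size la <= n)%N]); last 2 first.
- by move=> la [].
- move=> la [[pla hla ola] /= nsz]; apply: schur_eq0 => //.
  by rewrite ltnNge; apply/negP => le; apply: nsz.
rewrite (reindex_fsbig conj_shape
  [set a | good (col_conf a) && (odd_excess (col_conf a) == k)]); last first.
  split.
  - move=> a /= /andP[ga /eqP oa]; split; last exact: size_conj_shape.
    split; [exact: conj_shape_partition | exact: head_conj_shape |].
    by rewrite (@odd_rows_excess N) ?conj_shape_partition ?head_conj_shape // height_conf_conj.
  - move=> a b /set_mem /= /andP[ga _] /set_mem /= /andP[gb _] e.
    by apply/ffunP => j; apply: val_inj; rewrite /= -!height_conj_shape // e.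
  - move=> la /= [[pla hla ola] sz]; have sla : sorted geq la by case/andP: pla.
    have le j : (height la j < n.+1)%N by rewrite ltnS (leq_trans (count_size _ _)).
    pose a : {ffun 'I_N -> 'I_n.+1} := [ffun j : 'I_N => inord (height la j)].
    have aE : col_conf a = height_conf N la.
      by apply/ffunP => j; rewrite !ffunE inordK.
    have ga : good (col_conf a).
      rewrite aE; apply/goodP; split=> [j|i j ij]; rewrite !ffunE //.
      by rewrite lez_nat; apply: sub_count => x /=; apply: leq_ltn_trans.
    exists a; first by rewrite ga aE -ola -odd_rows_excess // eqxx.
    apply: (@partition_ext_height N) => //.
    + exact: conj_shape_partition.
    + exact: head_conj_shape.
    + by move=> j jN; rewrite (height_conj_shape (Ordinal jN)) // ffunE inordK.
rewrite fsbig_pred.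
transitivity (\sum_(a | good (col_conf a) && (odd_excess (col_conf a) == k))
    1 * walk (ups (mvars n)) (delta _ (col_conf a)) 0).
  apply: eq_bigr => a /andP[ga _]; rewrite mul1r.
  by rewrite (schur_walk n0 (sorted_conj_shape a) (head_conj_shape ga)) height_conf_conj.
rewrite -walk_sum; apply: (@eq_walk_good _ _ _ _ _ 0).
- by rewrite all_map; apply/allP.
- exact: good0.
- by move=> i; rewrite ffunE.
move=> q gq; rewrite add0n size_map size_mvars => qn.
have /goodP[q0 _] := gq.
pose a : {ffun 'I_N -> 'I_n.+1} := [ffun j => inord (absz (q j))].
have aE : col_conf a = q.
  apply/ffunP => j; rewrite [LHS]ffunE [a j]ffunE inordK ?gez0_abs // ltnS -lez_nat.
  by rewrite gez0_abs.
rewrite big_mkcond (bigD1 a) //= big1 => [|b ne].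
  by rewrite aE gq /= addr0 /delta eqxx mul1r; case: eqP.
case: ifP => // _; rewrite mul1r /delta; case: eqP => // e; case/eqP: ne.
apply/ffunP => j; apply: val_inj.
have := congr1 (fun q : {ffun 'I_N -> int} => q j) (etrans aE e).
by rewrite /= !ffunE => -[->].
Qed.

End SumOverShapes.

(** * Up-down tableaux as walks of row lengths *)

Section RowShape.
Variable w : nat.
Implicit Types q : {ffun 'I_w -> int}.

Definition row_seq q : seq nat := [seq absz (q j) | j <- enum 'I_w].
(** The height of column 0 is the number of nonzero rows, so [take] removes exactly the zero padding
    of a good [q]. *)
Definition row_shape q : seq nat := take (height (row_seq q) 0) (row_seq q).

Lemma nth_row_seq q r : nth 0%N (row_seq q) r = absz (ext q r).
Proof.
have [lt|ge] := ltnP r w; last by rewrite nth_default ?ext_ge // size_map size_enum_ord.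
rewrite (nth_map (Ordinal lt)) ?size_enum_ord // (ext_lt _ lt).
by rewrite -[r in nth _ _ r]/(val (Ordinal lt)) nth_ord_enum.
Qed.

Lemma sorted_row_seq q : good q -> sorted geq (row_seq q).
Proof.
move=> gq; apply/(sortedP 0%N) => i _; rewrite !nth_row_seq /=.
have [h1 h2] := ext_good i gq; have [h3 _] := ext_good i.+1 gq.
by rewrite -lez_nat !gez0_abs.
Qed.

Lemma nth_row_shape q r : good q -> nth 0%N (row_shape q) r = absz (ext q r).
Proof.
move=> gq; rewrite -nth_row_seq /row_shape.
have [lt|ge] := ltnP r (height (row_seq q) 0); first by rewrite nth_take.
rewrite nth_default; last by rewrite size_take_min (leq_trans _ ge) // geq_minl.
by apply/esym/eqP; rewrite -leqn0 leqNgt lt_height ?sorted_row_seq // -leqNgt.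
Qed.

Lemma row_shape_partition q : good q -> is_partition (row_shape q).
Proof.
move=> gq; rewrite /is_partition take_sorted ?sorted_row_seq //=.
apply/negP => /(nthP 0%N)[r]; rewrite size_take_min leq_min => /andP[lt _].
by rewrite nth_take // => e; move: lt; rewrite -lt_height ?sorted_row_seq // e.
Qed.

Lemma size_row_shape q : (size (row_shape q) <= w)%N.
Proof.
rewrite size_take_min (leq_trans (geq_minr _ _)) //.
by rewrite size_map size_enum_ord.
Qed.

Lemma sumn_row_shape q : good q -> sumn (row_shape q) = (\sum_j absz (q j))%N.
Proof.
move=> gq; transitivity (sumn (row_seq q)); last first.
  by rewrite sumnE big_map big_enum.
rewrite -[X in _ = sumn X](cat_take_drop (height (row_seq q) 0)) sumn_cat -/(row_shape q).
rewrite [sumn (drop _ _)](_ : _ = 0)%N ?addn0 // sumnE big1_seq // => x /= /(nthP 0%N)[r _].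
rewrite nth_drop => <-; apply/eqP; rewrite -leqn0 leqNgt lt_height ?sorted_row_seq //.
by rewrite -leqNgt leq_addr.
Qed.

Lemma row_shape0 : row_shape 0 = [::].
Proof.
apply: partition_ext => //; first exact: row_shape_partition (good0 _).
by move=> r; rewrite nth_row_shape ?good0 // ext0 nth_nil.
Qed.

Lemma row_shape_inj q q' : good q -> good q' -> row_shape q = row_shape q' -> q = q'.
Proof.
move=> gq gq' e; apply/ffunP => j.
have := congr1 (fun s => nth 0%N s j) e; rewrite /= !nth_row_shape // !ext_ord.
by have /goodP[/(_ j) h _] := gq; have /goodP[/(_ j) h' _] := gq'; lia.
Qed.

Lemma row_shape_eq q (la : seq nat) : good q -> is_partition la -> (size la <= w)%N ->
  (forall j : 'I_w, q j = (nth 0%N la j)%:Z) -> row_shape q = la.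
Proof.
move=> gq pla sla e; apply: partition_ext => //; first exact: row_shape_partition.
move=> r; rewrite nth_row_shape //; have [lt|ge] := ltnP r w; first by rewrite ext_lt e.
by rewrite ext_ge // nth_default // (leq_trans sla).
Qed.

Lemma partition_good q (la : seq nat) : is_partition la ->
  (forall j : 'I_w, q j = (nth 0%N la j)%:Z) -> good q.
Proof.
move=> /andP[sla _] e; apply/goodP; split=> [j|i j ij]; rewrite !e //.
by rewrite lez_nat leqNgt lt_height // -leqNgt (leq_trans _ ij) // leqNgt -lt_height // ltnn.
Qed.

End RowShape.

Section UpDownTableaux.
Variables (n w : nat).
Local Notation l := (updowns (mvars n)).
Local Notation eps := {ffun 'I_w -> bool}.
Implicit Types E : (2 * n).-tuple eps.

Lemma size_updowns (R : comNzRingType) (xs : seq R) : size (updowns xs) = (2 * size xs)%N.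
Proof. by elim: xs => [//|x xs IH] /=; rewrite IH; lia. Qed.

Lemma nth_updowns (R : comNzRingType) (xs : seq R) i : (i < size xs)%N ->
  nth (0, 0) (updowns xs) (2 * i) = (1, nth 0 xs i) /\
  nth (0, 0) (updowns xs) (2 * i).+1 = (-1, nth 0 xs i).
Proof.
elim: xs i => [//|x xs IH] [|i] // ilt.
by rewrite (_ : (2 * i.+1 = (2 * i).+2)%N); [exact: IH | lia].
Qed.

Lemma confS (R : comNzRingType) N (s : seq (int * R)) (E : seq {ffun 'I_N -> bool}) a k j :
  conf s E a.+1 k j
  = conf s E a k j + if nth (e0 N) E a j then (nth (0, 0) s a).1 else 0.
Proof. by rewrite !ffunE big_ord_recr addrA. Qed.

Definition closed_path E : bool :=
  [forall i : 'I_(2 * n), good (conf l E i.+1 0)] && (conf l E (2 * n) 0 == 0).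

Definition path_tableau E : (2 * n).+1.-tuple (seq nat) :=
  [tuple row_shape (conf l E i 0) | i < (2 * n).+1].

Lemma nth_path_tableau E i : (i <= 2 * n)%N ->
  nth [::] (path_tableau E) i = row_shape (conf l E i 0).
Proof.
by move=> ile; rewrite -[i]/(val (Ordinal (ile : (i < (2 * n).+1)%N))) -tnth_nth tnth_mktuple.
Qed.

Lemma closed_path_good E i : closed_path E -> (i <= 2 * n)%N -> good (conf l E i 0).
Proof.
move=> /andP[/forallP gE _]; case: i => [|i] ile; first by rewrite conf0 good0.
exact: gE (Ordinal ile).
Qed.

Lemma conf_up E i j : (i < n)%N ->
  conf l E (2 * i).+1 0 j = conf l E (2 * i) 0 j + (nth (e0 w) E (2 * i) j)%:Z.
Proof.
move=> lt; rewrite confS; have [-> _] := @nth_updowns _ (mvars n) i (ltac:(by rewrite size_mvars)).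
by case: (nth (e0 w) E (2 * i) j).
Qed.

Lemma conf_down E i j : (i < n)%N ->
  conf l E (2 * i).+1 0 j = conf l E (2 * i).+2 0 j + (nth (e0 w) E (2 * i).+1 j)%:Z.
Proof.
move=> lt; rewrite (confS _ _ (2 * i).+1).
have [_ ->] := @nth_updowns _ (mvars n) i (ltac:(by rewrite size_mvars)).
by case: (nth (e0 w) E (2 * i).+1 j); rewrite /= ?subrK ?addr0.
Qed.

Lemma strip_of_conf (q q' : {ffun 'I_w -> int}) (e : 'I_w -> bool) :
  good q -> good q' -> (forall j, q' j = q j + (e j)%:Z) ->
  vertical_strip (row_shape q) (row_shape q').
Proof.
move=> gq gq' h.
have ex r : ext q' r = ext q r \/ ext q' r = ext q r + 1.
  have [lt|ge] := ltnP r w; last by left; rewrite !ext_ge.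
  by rewrite !ext_lt h; case: (e _); [right | left; rewrite addr0].
split=> r; rewrite !nth_row_shape //; have [h0 _] := ext_good r gq; case: (ex r) => ->; lia.
Qed.

Lemma path_tableau_bij :
  functions.set_bij [set E | closed_path E] (UD w [::] [::]) path_tableau.
Proof.
split.
- move=> E /= cE; have gE := @closed_path_good E _ cE.
  split.
  + by rewrite nth_path_tableau // conf0 row_shape0.
  + by rewrite nth_path_tableau //; case/andP: cE => _ /eqP ->; rewrite row_shape0.
  + move=> i ile; rewrite nth_path_tableau //.
    by split; [apply: row_shape_partition; apply: gE | apply: size_row_shape].
  + move=> i lt; rewrite !nth_path_tableau; [|lia..].
    split.
      apply: (@strip_of_conf _ _ (fun j => nth (e0 w) E (2 * i) j)); [apply: gE; lia..|].
      by move=> j; apply: conf_up.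
    apply: (@strip_of_conf _ _ (fun j => nth (e0 w) E (2 * i).+1 j)); [apply: gE; lia..|].
    by move=> j; apply: conf_down.
- move=> E E' /set_mem /= cE /set_mem /= cE' e.
  have ec i : (i <= 2 * n)%N -> conf l E i 0 = conf l E' i 0.
    move=> ile; apply: row_shape_inj; [exact: closed_path_good..|].
    by rewrite -!nth_path_tableau // e.
  apply: eq_from_tnth => a; rewrite !(tnth_nth (e0 w)); apply/ffunP => j.
  have := congr1 (fun q : {ffun 'I_w -> int} => q j) (ec a.+1 (ltn_ord a)).
  rewrite /= !confS ec ?(ltnW (ltn_ord a)) // => /addrI.
  (* Moves have nonzero size, so two successive configurations tell which particles moved. *)
  have s0 : (nth (0, 0) l a).1 != 0.
    have hn : (a./2 < size (mvars n))%N by rewrite size_mvars; have := ltn_ord a; lia.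
    have [h1 h2] := nth_updowns hn.
    have [|] : a = (2 * a./2)%N :> nat \/ a = (2 * a./2).+1 :> nat by lia.
      by move=> ->; rewrite h1.
    by move=> ->; rewrite h2.
  by case: (nth (e0 w) E a j); case: (nth (e0 w) E' a j) => // /eqP;
    rewrite ?[0 == _]eq_sym (negbTE s0).
- move=> T [T0 T2n Tp Ts] /=.
  (* A row moves exactly when its length changes; the parity of the step fixes the direction. *)
  pose E : (2 * n).-tuple eps := [tuple [ffun j : 'I_w =>
    nth 0%N (nth [::] T a) j != nth 0%N (nth [::] T a.+1) j] | a < 2 * n].
  have nE a j : (a < 2 * n)%N -> nth (e0 w) E a j
      = (nth 0%N (nth [::] T a) j != nth 0%N (nth [::] T a.+1) j).
    by move=> lt; rewrite -[a in LHS]/(val (Ordinal lt)) -tnth_nth tnth_mktuple ffunE.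
  have cE i : (i <= n)%N ->
     (forall j : 'I_w, conf l E (2 * i) 0 j = (nth 0%N (nth [::] T (2 * i)) j)%:Z)
     /\ ((i < n)%N -> forall j : 'I_w,
         conf l E (2 * i).+1 0 j = (nth 0%N (nth [::] T (2 * i).+1) j)%:Z).
    have half k : (k < n)%N ->
        (forall j : 'I_w, conf l E (2 * k) 0 j = (nth 0%N (nth [::] T (2 * k)) j)%:Z) ->
        forall j : 'I_w, conf l E (2 * k).+1 0 j = (nth 0%N (nth [::] T (2 * k).+1) j)%:Z.
      move=> lt h j; rewrite conf_up // h nE; last by lia.
      have [[c s] _] := Ts k lt; have := c j; have := s j.
      by case: eqP => /=; lia.
    elim: i => [|i IH] ile.
      have base (j : 'I_w) : conf l E (2 * 0) 0 j = (nth 0%N (nth [::] T (2 * 0)) j)%:Z.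
        by rewrite muln0 conf0 T0 nth_nil ffunE.
      by split=> // lt; apply: half.
    have [_ /(_ ile) h] := IH (ltnW ile).
    have base (j : 'I_w) : conf l E (2 * i.+1) 0 j = (nth 0%N (nth [::] T (2 * i.+1)) j)%:Z.
      have e2 : (2 * i.+1 = (2 * i).+2)%N by lia.
      rewrite e2; have := conf_down E j ile; rewrite h nE; last by lia.
      have [_ [c s]] := Ts i ile; have := c j; have := s j.
      by case: eqP => /=; lia.
    by split=> // lt; apply: half.
  have cT a (j : 'I_w) : (a <= 2 * n)%N -> conf l E a 0 j = (nth 0%N (nth [::] T a) j)%:Z.
    move=> ale; have [e|e] : a = (2 * a./2)%N \/ a = (2 * a./2).+1 by lia.
      have hle : (a./2 <= n)%N by lia.
      by have [h _] := cE _ hle; move: (h j); rewrite -e.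
    have hlt : (a./2 < n)%N by lia.
    by have [_ /(_ hlt) h] := cE _ (ltnW hlt); move: (h j); rewrite -e.
  have gc a : (a <= 2 * n)%N -> good (conf l E a 0).
    by move=> ale; apply: partition_good (Tp a ale).1 _ => j; apply: cT.
  exists E.
    apply/andP; split; first by apply/forallP => a; apply: gc.
    by apply/eqP/ffunP => j; rewrite cT // T2n nth_nil ffunE.
  apply: eq_from_tnth => a; rewrite !(tnth_nth [::]).
  have ale : (a <= 2 * n)%N by have := ltn_ord a; lia.
  rewrite nth_path_tableau //; apply: row_shape_eq => //.
  + exact: gc.
  + by have [] := Tp a ale.
  + by have [] := Tp a ale.
  + by move=> j; apply: cT.
Qed.

Lemma prod_pairs (R : comNzRingType) m (F : nat -> R) :
  \prod_(a < 2 * m) F a = \prod_(i < m) (F (2 * i)%N * F (2 * i).+1).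
Proof.
elim: m => [|m IH]; first by rewrite muln0 !big_ord0.
by rewrite mulnS !big_ord_recr /= -IH mulrA.
Qed.

(** The exponent of ['X_i] counts the cells added by its up move plus those removed by its down
    move. *)
Lemma path_tableau_weight E : closed_path E ->
  ud_weight (path_tableau E)
  = \prod_(a < 2 * n) (nth (0, 0) l a).2 ^+ (\sum_j nth (e0 w) E a j)%N.
Proof.
move=> cE; rewrite (prod_pairs n (fun a => (nth (0, 0) l a).2 ^+ (\sum_j nth (e0 w) E a j)%N)).
apply: eq_bigr => i _.
have lt := ltn_ord i.
have [-> ->] : nth (0, 0) l (2 * i) = (1, 'X_i) /\ nth (0, 0) l (2 * i).+1 = (-1, 'X_i).
  by have := @nth_updowns _ (mvars n) i; rewrite size_mvars nth_mvars; apply.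
rewrite -exprD; congr (_ ^+ _); rewrite /ud_exp !nth_path_tableau; [|lia..].
have gE := @closed_path_good E _ cE.
rewrite !sumn_row_shape; [|apply: gE; lia..].
have up : (\sum_j absz (conf l E (2 * i).+1 0%R j)
    = \sum_j absz (conf l E (2 * i) 0%R j) + \sum_j nth (e0 w) E (2 * i) j)%N.
  rewrite -big_split /=; apply: eq_bigr => j _; rewrite conf_up //.
  have /goodP[/(_ j) h _] : good (conf l E (2 * i) 0) by apply: gE; lia.
  by lia.
have down : (\sum_j absz (conf l E (2 * i).+1 0%R j)
    = \sum_j absz (conf l E (2 * i).+2 0%R j) + \sum_j nth (e0 w) E (2 * i).+1 j)%N.
  rewrite -big_split /=; apply: eq_bigr => j _; rewrite conf_down //.
  have /goodP[/(_ j) h _] : good (conf l E (2 * i).+2 0) by apply: gE; lia.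
  by lia.
by lia.
Qed.

Lemma sum_UD_walk :
  \sum_(T \in @UD n w [::] [::]) ud_weight T
  = walk l (delta _ (0 : {ffun 'I_w -> int})) 0.
Proof.
rewrite (reindex_fsbig _ _ _ _ path_tableau_bij) fsbig_pred.
rewrite (@walkE _ _ (2 * n)); last by rewrite size_updowns size_mvars.
rewrite big_mkcond [RHS]big_mkcond; apply: eq_bigr => E _.
case: ifP => cE.
  rewrite path_tableau_weight //; case/andP: cE => -> /eqP e.
  by rewrite /delta e eqxx mulr1.
move: cE; rewrite /closed_path; case: ifP => //= _ ne.
by rewrite /delta ne mulr0.
Qed.

End UpDownTableaux.

(** * Elementary symmetric polynomials and the final product *)

Lemma mpoly_natr_neq0 (n m : nat) : m.+1%:R != 0 :> {mpoly int[n]}.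
Proof. by rewrite -(rmorph_nat (@mpolyC n int)) mpolyC_eq0 pnatr_eq0. Qed.

Lemma coef_prod_mvars (n k : nat) :
  (\prod_(x <- mvars n) (1 + 'X * x%:P))`_k
  = \sum_(S : {set 'I_n} | #|S| == k) set_weight S.
Proof.
rewrite big_map big_enum /=; under eq_bigr => i _ do rewrite addrC.
rewrite bigA_distr coef_sum [RHS]big_mkcond; apply: eq_bigr => S _.
have -> : \prod_i (if i \in S then 'X * ('X_i : {mpoly int[n]})%:P else 1)
    = (set_weight S)%:P * 'X^#|S|.
  rewrite -big_mkcond big_split /= prodr_const mulrC; congr (_ * _).
  by rewrite /set_weight rmorph_prod.
by rewrite coefCM coefXn eq_sym; case: eqP => _; rewrite ?mulr1 ?mulr0.
Qed.

Theorem theorem7p7 (k w n : nat) (hkw : (k <= w)%N) (hn : (1 <= n)%N) :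
  \sum_(la \in [set la : seq nat | [/\ is_partition la,
                                       (head 0 la <= 2 * w + 1)%N
                                     & odd_rows la = k]]) schur n la
  = \sum_(TS \in [set TS | MUD (n := n) w [::] [::] TS /\ #|TS.2| = k])
      ud_weight TS.1 * set_weight TS.2.
Proof.
(* The bound on the first row counts columns: [w] pairs and the one column that a vertical strip may
   add. *)
have -> : (2 * w + 1)%N = (w + w).+1 by lia.
rewrite (sum_schur_walk _ k hn) (walk_odd_excess_eq (@mpoly_natr_neq0 n)).
rewrite coef_prod_mvars -sum_UD_walk -fsbig_pred.
have -> : [set TS | @MUD n w [::] [::] TS /\ #|TS.2| = k]
    = @UD n w [::] [::] `*` [set S : {set 'I_n} | #|S| == k].
  by apply/seteqP; split=> -[T S] [/= h /eqP].
rewrite -(@pair_fsbig _ _ _ _ _ _ _ (fun T S => ud_weight T * set_weight S)); last 2 first.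
- exact: finite_UD.
- exact: finite_finset.
rewrite mulrC mulr_fsuml; apply: eq_fsbigr => T _.
by rewrite mulr_fsumr.
Qed.
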